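(* Let $d\ge 1$, let $-\frac{1}{d+1}<s<0$, and let $Q\in\mathcal{Q}_0\cap\mathcal{Q}_1$ be a probability measure on $\mathbb{R}^d$. Then the minimization problem $\min_{g\in\mathcal{G}}L_s(g,Q)$ achieves its nontrivial (finite) minimum at some $\tilde g\in\mathcal{G}$. Moreover, $\tilde g$ is bounded away from zero, and $\tilde f:=\tilde g^{1/s}$ is a bounded (probability) density with respect to Lebesgue measure $\lambda_d$ on $\mathbb{R}^d$.
   Context: Here $\beta:=1+1/s<0$ and $\|\cdot\|$ is the Euclidean norm. $\mathcal{G}$ denotes the class of all closed (i.e. lower semicontinuous) convex functions $g:\mathbb{R}^d\to[0,\infty]$ whose effective domain $\mathrm{dom}(g)=\{g<\infty\}$ has non-empty interior and which are coercive: $g(x)\to\infty$ as $\|x\|\to\infty$. For $g\in\mathcal{G}$ and a probability measure $Q$ on $\mathbb{R}^d$, $L_s(g,Q):=\int g\,dQ+\frac{1}{|\beta|}\int_{\mathbb{R}^d}g(x)^\beta\,dx$, with the conventions $\infty^{1/s}=\infty^{\beta}=0$ and $0^{1/s}=0^{\beta}=\infty$. The convex support $\mathrm{csupp}(Q)$ is the intersection of all closed convex sets $C\subset\mathbb{R}^d$ with $Q(C)=1$. $\mathcal{Q}_0$ is the set of probability measures on $\mathbb{R}^d$ whose convex support has non-empty interior; $\mathcal{Q}_1$ is the set of probability measures $Q$ with $\int\|x\|\,Q(dx)<\infty$. *)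

(* Defs.v *)
From HB Require Import structures.
From mathcomp Require Import all_boot all_order all_algebra.
From mathcomp Require Import all_classical all_reals all_analysis.
From mathcomp Require Import measurable_realfun measure_function.

Set Implicit Arguments.
Unset Strict Implicit.
Unset Printing Implicit Defensive.

Import Order.TTheory GRing.Theory Num.Theory.
Import numFieldNormedType.Exports.

Local Open Scope classical_set_scope.
Local Open Scope ring_scope.

(** R^d is ['rV[R]_d]. The library topology on it is the product topology;
    [borelRd R d] is the same type with its Borel sigma-algebra. *)
Notation borelRd R d := (g_sigma_algebraType (@open 'rV[R]_d)).

Lemma measurable_coord (R : realType) (d : nat) (i : 'I_d) :
  measurable_fun [set: borelRd R d]
    (fun v : borelRd R d => (v : 'rV[R]_d) ord0 i).
Proof.
apply: (measurability _ (RGenOInfty.measurableE R)).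
move=> _ [_ [a ->] <-]; rewrite setTI; apply: sub_sigma_algebra.
apply: (@open_comp _ _ (fun v : 'rV[R]_d => v ord0 i)).
  by move=> v _; exact: coord_continuous.
by rewrite set_itvoy; exact: open_gt.
Qed.

Lemma measurable_box (R : realType) (d : nat) (A : 'I_d -> set R) :
  (forall i, measurable (A i)) ->
  measurable ([set v : 'rV[R]_d | forall i, A i (v ord0 i)] : set (borelRd R d)).
Proof.
move=> mA; rewrite (_ : mkset _ = \bigcap_(i : 'I_d)
    ([set: borelRd R d] `&`
     (fun v : borelRd R d => (v : 'rV[R]_d) ord0 i) @^-1` A i)).
  by apply: fin_bigcap_measurable => // i _; exact: measurable_coord.
apply/seteqP; split => [x h i _|x h i]; first by split => //; exact: h.
by have [] := h i I.
Qed.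

Section measurable_row.
Context (dT : measure_display) (T : measurableType dT) (R : realType) (d : nat).

Lemma measurable_row (f : T -> borelRd R d) :
  (forall i, measurable_fun [set: T] (fun x => (f x : 'rV[R]_d) ord0 i)) ->
  measurable_fun [set: T] f.
Proof.
move=> mf.
apply: (@measurability _ _ T (borelRd R d) setT f (@open 'rV[R]_d)) => // _ [U oU <-]; rewrite setTI.
pose B (p : 'rV[rat]_d * nat) : set 'rV[R]_d :=
  [set v | forall i, `|ratr (p.1 ord0 i) - v ord0 i| < p.2.+1%:R^-1].
have -> : f @^-1` U = \bigcup_(p : 'rV[rat]_d * nat)
    (if `[< B p `<=` U >] then f @^-1` (B p) else set0).
  apply/seteqP; split => [x Ux|x [p _]]; last first.
    by case: ifPn => // /asboolP BU /BU.
  have /nbhs_ballP[e /= e0 eU] : nbhs (f x : 'rV[R]_d) U.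
    by apply: open_nbhs_nbhs.
  have [n ne] : exists n, (2 * n.+1%:R^-1 < e)%R.
    have e2 : 0 < e / 2 by rewrite divr_gt0.
    exists (Num.truncn (e / 2)^-1).
    rewrite mulrC -ltr_pdivlMr// invf_plt ?posrE//; exact: truncnS_gt.
  have /(_ _)/cid-/all_sig[q qP] : forall i : 'I_d, exists q : rat,
      `|ratr q - (f x : 'rV[R]_d) ord0 i| < n.+1%:R^-1.
    move=> i; set a := (f x : 'rV[R]_d) ord0 i.
    have [|q] := @rat_in_itvoo R a (a + n.+1%:R^-1).
      by rewrite ltrDl.
    rewrite in_itv/= => /andP[aq qa]; exists q.
    by rewrite gtr0_norm ?subr_gt0// ltrBlDl.
  exists (\row_i q i, n) => //; case: ifPn => [_ i|].
    by rewrite /= mxE; exact: qP.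
  case/asboolP => v vB; apply: eU; split => // i j.
  rewrite /ball/= (ord1 i) (le_lt_trans _ ne)//.
  have := vB j; rewrite /= mxE => vj.
  rewrite -(subrK (ratr (q j)) (_ ord0 j)) -addrA.
  rewrite (le_trans (ler_normD _ _))// mulr_natl mulr2n lerD//.
    by rewrite distrC ltW// qP.
  exact: ltW.
apply: countable_bigcupT_measurable => [|p]; first exact: countableP.
case: ifPn => // _.
rewrite (_ : _ @^-1` _ = \bigcap_(i : 'I_d) [set x |
    `|ratr (p.1 ord0 i) - (f x : 'rV[R]_d) ord0 i| < p.2.+1%:R^-1]); last first.
  by apply/seteqP; split => [x h i _|x h i]; [exact: h|exact: (h i I)].
apply: fin_bigcap_measurable => // i _.
rewrite (_ : [set _ | _] = setT `&` (fun x => (f x : 'rV[R]_d) ord0 i) @^-1`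
    (ball (ratr (p.1 ord0 i) : R) p.2.+1%:R^-1)).
  by apply: mf => //; exact: measurable_ball.
by rewrite setTI.
Qed.

End measurable_row.

Section lebesgueRd.
Context (R : realType).
Local Open Scope ereal_scope.

Definition consRd (d : nat) (p : measurableTypeR R * borelRd R d) :
  borelRd R d.+1 :=
  \row_(i < d.+1) (oapp ((p.2 : 'rV[R]_d) ord0) p.1 (unlift ord0 i)).

Definition unconsRd (d : nat) (v : borelRd R d.+1) :
    measurableTypeR R * borelRd R d :=
  ((v : 'rV[R]_d.+1) ord0 ord0,
   \row_(i < d) (v : 'rV[R]_d.+1) ord0 (lift ord0 i)).

Lemma consRdK (d : nat) : cancel (@consRd d) (@unconsRd d).
Proof.
move=> [a v]; rewrite /unconsRd /consRd mxE unlift_none/=; congr pair.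
by apply/rowP => i; rewrite !mxE liftK.
Qed.

Lemma measurable_consRd (d : nat) :
  measurable_fun [set: measurableTypeR R * borelRd R d] (@consRd d).
Proof.
apply: measurable_row => i; rewrite /consRd.
have [j ->|->] := unliftP ord0 i.
  under eq_fun do rewrite mxE liftK/=.
  exact: (measurableT_comp (measurable_coord j) measurable_snd).
under eq_fun do rewrite mxE unlift_none/=.
exact: measurable_fst.
Qed.

Lemma measurable_unconsRd (d : nat) :
  measurable_fun [set: borelRd R d.+1] (@unconsRd d).
Proof.
apply: measurable_fun_pair => /=; first exact: measurable_coord.
apply: measurable_row => i.
under eq_fun do rewrite mxE.
exact: measurable_coord.
Qed.

Section succ.
Context (d : nat) (m : {sigma_finite_measure set (borelRd R d) -> \bar R}).

Definition lebesgueRd_succ : set (borelRd R d.+1) -> \bar R :=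
  pushforward (@lebesgue_measure R \x m) (@consRd d).

Let m12 : {measure set (measurableTypeR R * borelRd R d) -> \bar R} :=
  @lebesgue_measure R \x m.

Let lebesgueRd_succ0 : lebesgueRd_succ set0 = 0.
Proof. by rewrite /lebesgueRd_succ /pushforward preimage_set0 measure0. Qed.

Let lebesgueRd_succ_ge0 A : 0 <= lebesgueRd_succ A.
Proof. exact: (measure_ge0 m12). Qed.

Let lebesgueRd_succ_sigma_additive : semi_sigma_additive lebesgueRd_succ.
Proof.
exact: (@measure_semi_sigma_additive _ _ _
  (measure_function_pushforward__canonical__measure_function_Measure
    m12 (@measurable_consRd d))).
Qed.

HB.instance Definition _ := isMeasure.Build _ _ _ lebesgueRd_succ
  lebesgueRd_succ0 lebesgueRd_succ_ge0 lebesgueRd_succ_sigma_additive.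

Let sigma_finite_succ : sigma_finite setT lebesgueRd_succ.
Proof.
have [F FT Foo] : sigma_finite setT (@lebesgue_measure R \x m).
  have /sigma_finiteP[F [TF ndF Foo]] := sigma_finiteT (@lebesgue_measure R).
  have /sigma_finiteP[G [TG ndG Goo]] := sigma_finiteT m.
  exists (fun n => F n `*` G n).
    rewrite -setXTT TF TG; apply/seteqP; split=> -[x y] /=.
      move=> [[n _ Fnx] [k _ Gky]]; exists (maxn n k) => //; split.
        by move: x Fnx; apply/subsetPset/ndF/leq_maxl.
      by move: y Gky; apply/subsetPset/ndG/leq_maxr.
    by move=> [n _ [? ?]]; split; exists n.
  move=> k; have [? ?] := Foo k; have [? ?] := Goo k.
  split; first exact: measurableX.
  by rewrite product_measure1E// lte_mul_pinfty// ge0_fin_numE.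
exists (fun n => @unconsRd d @^-1` F n).
  by rewrite -preimage_bigcup -FT preimage_setT.
move=> n; have [mF mFoo] := Foo n; split.
  by rewrite -[X in measurable X]setTI; exact: measurable_unconsRd.
rewrite /lebesgueRd_succ /pushforward -comp_preimage.
rewrite (_ : _ \o _ = id) ?preimage_id//.
by apply/funext => p; exact: consRdK.
Qed.

HB.instance Definition _ := @Measure_isSigmaFinite.Build _ _ _
  lebesgueRd_succ sigma_finite_succ.

End succ.

(** d-dimensional Lebesgue measure on the Borel sets: the d-fold product of
    [lebesgue_measure]; on R^0 it is the unit mass at the only point. *)
Fixpoint lebesgueRd (d : nat) :
    {sigma_finite_measure set (borelRd R d) -> \bar R} :=
  if d is d'.+1 then [the {sigma_finite_measure set _ -> \bar R} of
    lebesgueRd_succ (lebesgueRd d')]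
  else [the {sigma_finite_measure set _ -> \bar R} of
    @dirac _ (borelRd R 0) 0%R R].

Lemma lebesgueRd_box (d : nat) (A : 'I_d -> set R) :
  (forall i, measurable (A i)) ->
  lebesgueRd d [set v : 'rV[R]_d | forall i, A i (v ord0 i)] =
  \prod_(i < d) lebesgue_measure (A i).
Proof.
elim: d A => [A _|d ih A mA] /=.
  by rewrite big_ord0 diracE mem_set// => -[].
rewrite big_ord_recl -(ih (A \o lift ord0))//.
rewrite /lebesgueRd_succ /pushforward -product_measure1E//.
  congr product_measure1; apply/seteqP; split => [[a v] /= h|[a v] /= [h0 h] i].
    split; first by have := h ord0; rewrite mxE unlift_none.
    by move=> i; have := h (lift ord0 i); rewrite mxE liftK.
  rewrite mxE; have [j ->|->] := unliftP ord0 i; [exact: h|exact: h0].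
- exact: mA.
- by apply: (@measurable_box R d (A \o lift ord0)) => i; exact: mA.
- by move=> i; exact: mA.
Qed.

End lebesgueRd.

Section s_concave.
Context (R : realType) (d : nat).
Local Open Scope ereal_scope.

(** The library norm on ['rV[R]_d] is the sup norm. *)
Definition enorm (x : 'rV[R]_d) : R :=
  Num.sqrt (\sum_(i < d) (x ord0 i) ^+ 2)%R.

(** [x ^ r] for [0 <= x <= +oo] and [r < 0], with [+oo ^ r = 0] and
    [0 ^ r = +oo]; the library's [poweR] has other values at these points. *)
Definition npoweR (x : \bar R) (r : R) : \bar R :=
  match x with
  | a%:E => if a == 0%R then +oo else (powR a r)%:E
  | +oo => 0
  | -oo => 0
  end.

Definition edom (g : 'rV[R]_d -> \bar R) : set 'rV[R]_d := [set x | g x < +oo].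

Definition econvex (g : 'rV[R]_d -> \bar R) : Prop :=
  forall (x y : 'rV[R]_d) (t : R), (0 <= t <= 1)%R ->
    g (t *: x + (1 - t) *: y)%R <= t%:E * g x + (1 - t)%:E * g y.

Definition ecoercive (g : 'rV[R]_d -> \bar R) : Prop :=
  forall M : R, exists r : R, forall x, (r < enorm x)%R -> M%:E <= g x.

Record classG (g : 'rV[R]_d -> \bar R) : Prop := ClassG {
  classG_ge0 : forall x, 0 <= g x;
  classG_lsc : lower_semicontinuous g;
  classG_convex : econvex g;
  classG_dom : (edom g)° !=set0;
  classG_coercive : ecoercive g }.

Definition Ls (s : R) (g : 'rV[R]_d -> \bar R)
    (Q : probability (borelRd R d) R) : \bar R :=
  let beta := (1 + s^-1)%R in
  \int[Q]_x g x + (`|beta|^-1)%:E * \int[lebesgueRd R d]_x npoweR (g x) beta.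

Definition csupp (Q : probability (borelRd R d) R) : set 'rV[R]_d :=
  \bigcap_(C in [set C : set 'rV[R]_d | [/\ closed C,
    convex_set (C : set (convex_lmodType 'rV[R]_d)) & Q C = 1]]) C.

Definition classQ0 (Q : probability (borelRd R d) R) : Prop :=
  (csupp Q)° !=set0.

Definition classQ1 (Q : probability (borelRd R d) R) : Prop :=
  \int[Q]_x (enorm x)%:E < +oo.

Definition bounded_away_from_zero (g : 'rV[R]_d -> \bar R) : Prop :=
  exists2 c : R, (0 < c)%R & forall x, c%:E <= g x.

Definition is_density (f : 'rV[R]_d -> \bar R) : Prop :=
  [/\ measurable_fun [set: borelRd R d] (f : borelRd R d -> \bar R),
      forall x, 0 <= f x & \int[lebesgueRd R d]_x f x = 1].

Definition ebounded (f : 'rV[R]_d -> \bar R) : Prop :=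
  exists M : R, forall x, `|f x| <= M%:E.

End s_concave.

(* Main.v *)
Require Import Defs.
From mathcomp Require Import all_boot all_order all_algebra.
From mathcomp Require Import all_classical all_reals all_analysis.
From mathcomp Require Import measurable_realfun measure_function.
From mathcomp Require Import ring lra.

(** The minimizer is found by the direct method, with epi-convergence as the
    notion of convergence. Write [b = 1 + 1/s]; the assumption on [s] says that
    [b < - d].

    Compactness is free: every sequence of functions on R^d has an
    epi-convergent subsequence ([epi_compact]). An epi-limit of nonnegative
    convex functions is nonnegative, convex and lower semicontinuous, and lies
    below the pointwise lower limit, so Fatou's lemma controls the integral
    against Q. In particular the limit g of a minimizing sequence is finite
    Q-almost everywhere, hence the closure of its domain contains the convex
    support of Q; a convex set whose closure has interior points has interior
    points itself ([cvx_closure_interior]), so the domain of g has nonempty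
    interior. On that interior epi-convergence of convex functions improves to
    the pointwise bound limsup g_n <= g ([epi_interior_lt]), outside the closure
    of the domain g is infinite, and the boundary of a convex set is a null set
    ([cvx_boundary_null]). So Fatou's lemma also controls the integral of g^b
    ([fatou_npoweR]), and g attains the infimum of the functional. The infimum
    is finite because 1 + |x|_1 is a competitor of finite value
    ([Ls_one_plus_norm1]).

    The lower bound and the coercivity of g come from g itself, not from the
    sequence: they hold for every nonnegative convex lower semicontinuous g
    whose domain has interior points and for which the integral of g^b is
    finite. If g took a very small value e at a point, convexity would keep g
    below 2e on a cube of side of order e, which contributes e^(b+d) up to a
    constant to the integral, and b + d < 0
    ([bounded_away_of_finite_integral]). If a sublevel set were unbounded,
    convexity would place cubes of fixed size in it arbitrarily far away,
    although its measure is finite ([coercive_of_finite_integral]).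

    Finally, comparing g with g + e and with g - e and using the tangent lines
    of the convex function y^b gives the Euler-Lagrange equation for constant
    perturbations, which says that g^(1/s) has total mass one
    ([minimizer_density]). *)

Set Implicit Arguments.
Unset Strict Implicit.
Unset Printing Implicit Defensive.

Import Order.TTheory GRing.Theory Num.Theory.
Import numFieldNormedType.Exports.

Local Open Scope classical_set_scope.
Local Open Scope ring_scope.

(** * Cubes and convex sets in R^d *)

Section boxes.
Context {R : realType} {d : nat}.
Local Notation V := 'rV[R]_d.
Implicit Types (x y z c : V) (C : set V).

(** For positive r these are the balls of ['rV[R]_d]. Written coordinatewise
    they are products of intervals, the sets whose Lebesgue measure is known. *)
Definition box x (r : R) : set V :=
  [set y | forall i, ball (x ord0 i) r (y ord0 i)].

Lemma box_le x r r' : r <= r' -> box x r `<=` box x r'.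
Proof. by move=> rr' y xy i; exact: le_ball (xy i). Qed.

Lemma box_sym x y r : box x r y -> box y r x.
Proof. by move=> xy i; exact/ball_sym/xy. Qed.

Lemma box_triangle x y z r r' : box x r y -> box y r' z -> box x (r + r') z.
Proof. by move=> xy yz i; exact: ball_triangle (xy i) (yz i). Qed.

Lemma nbhs_box x r : 0 < r -> nbhs x (box x r).
Proof.
move=> r0; apply/nbhs_ballP; exists r => //= y [_ xy] i; exact: xy.
Qed.

Lemma nbhs_boxP x (U : set V) :
  nbhs x U <-> exists2 r : R, 0 < r & box x r `<=` U.
Proof.
split=> [/nbhs_ballP[r /= r0 rU]|[r r0 rU]].
  exists r => // y xy; apply: rU; split=> // i j.
  by rewrite (ord1 i); exact: xy.
by apply: filterS rU _; exact: nbhs_box.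
Qed.

Lemma open_box x r : open (box x r).
Proof.
rewrite openE => y xy.
have {xy} : forall i, nbhs (y ord0 i) (ball (x ord0 i) r).
  move=> i; have := xy i; rewrite -ball_normE /= => xyi.
  apply/nbhs_ballP; exists (r - `|x ord0 i - y ord0 i|).
    by rewrite /= subr_gt0.
  move=> u; rewrite -ball_normE /= => yu.
  rewrite (le_lt_trans (ler_distD (y ord0 i) _ _))//; lra.
move=> h; exists (fun _ i => ball (x ord0 i) r).
  by move=> i j; rewrite (ord1 i); exact: h.
by move=> z zh i; exact: zh.
Qed.

(** A countable base of the topology, indexed by a type with a canonical
    enumeration. *)
Definition qbox (p : 'rV[rat]_d * nat) : set V :=
  box (map_mx ratr p.1) p.2.+1%:R^-1.

Lemma qbox_base x (U : set V) : nbhs x U ->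
  exists p, qbox p x /\ qbox p `<=` U.
Proof.
move=> /nbhs_boxP[e e0 eU].
have [n ne] : exists n, (2 * n.+1%:R^-1 : R) < e.
  have e2 : 0 < e / 2 by rewrite divr_gt0.
  exists (Num.truncn (e / 2)^-1).
  rewrite mulrC -ltr_pdivlMr// invf_plt ?posrE//; exact: truncnS_gt.
have /(_ _)/cid-/all_sig[q qP] : forall i : 'I_d, exists q : rat,
    (`|ratr q - x ord0 i| : R) < n.+1%:R^-1.
  move=> i; set a := x ord0 i.
  have [|q] := @rat_in_itvoo R a (a + n.+1%:R^-1).
    by rewrite ltrDl.
  rewrite in_itv/= => /andP[aq qa]; exists q.
  by rewrite gtr0_norm ?subr_gt0// ltrBlDl.
exists (\row_i q i, n); have qx : qbox (\row_i q i, n) x.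
  by move=> i; rewrite !mxE -ball_normE /=; exact: qP.
split=> // y /(box_triangle (box_sym qx)) xy.
have dbl (u v : R) : 2 * u < v -> u + u <= v by lra.
by apply: eU; apply: box_le xy; apply: dbl; exact: ne.
Qed.

Definition cvx C := forall x y (t : R), 0 <= t <= 1 -> C x -> C y ->
  C (t *: x + (1 - t) *: y).

Lemma cvx_convex_set C :
  cvx C -> convex_set (C : set (convex_lmodType V)).
Proof.
move=> cC x y l; rewrite !inE => Cx Cy.
by apply: (cC x y l%:num) => //; apply/andP; split; [exact: ge0|exact: le1].
Qed.

Lemma closure_boxP C x :
  closure C x <-> forall r : R, 0 < r -> exists2 y, C y & box x r y.
Proof.
split=> [Cx r r0|h U /nbhs_boxP[r r0 rU]].
  by have [y [Cy xy]] := Cx _ (nbhs_box x r0); exists y.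
by have [y Cy xy] := h _ r0; exists y; split => //; exact: rU.
Qed.

Lemma box_conv x y x' y' (t r : R) : 0 <= t <= 1 -> box x r x' -> box y r y' ->
  box (t *: x + (1 - t) *: y) r (t *: x' + (1 - t) *: y').
Proof.
move=> /andP[t0 t1] xx yy i.
have := xx i; have := yy i; rewrite -!ball_normE /= !mxE => yyi xxi.
rewrite (_ : _ - _ = t * (x ord0 i - x' ord0 i)
                   + (1 - t) * (y ord0 i - y' ord0 i)); last by ring.
rewrite (le_lt_trans (ler_normD _ _))// !normrM (ger0_norm t0).
rewrite (@ger0_norm _ (1 - t)) ?subr_ge0//.
have [->|tn0] := eqVneq t 0; first by rewrite subr0 mul0r add0r mul1r.
have : t * `|x ord0 i - x' ord0 i| < t * r.
  by rewrite ltr_pM2l// lt_neqAle eq_sym tn0.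
have : (1 - t) * `|y ord0 i - y' ord0 i| <= (1 - t) * r.
  by rewrite ler_wpM2l ?subr_ge0// ltW.
lra.
Qed.

Lemma closure_cvx C : cvx C -> cvx (closure C).
Proof.
move=> cC x y t t01 /closure_boxP Cx /closure_boxP Cy.
apply/closure_boxP => r r0.
have [x' Cx' xx'] := Cx _ r0; have [y' Cy' yy'] := Cy _ r0.
by exists (t *: x' + (1 - t) *: y'); [exact: cC|exact: box_conv].
Qed.

(** The coordinates of z are reached one at a time: two points of C that agree
    with z in the first k coordinates and lie on opposite sides of z in the next
    one have a convex combination that agrees with z there too, and convex
    combinations preserve the sign conditions on the later coordinates. *)
Lemma cvx_orthants C z (a : R) :
  cvx C -> (forall i, `|z ord0 i| <= a) ->
  (forall s : 'I_d -> bool,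
     exists2 w, C w & forall i, a <= (-1) ^+ s i * w ord0 i) ->
  C z.
Proof.
move=> cC za Cs.
suff H k : (k <= d)%N -> forall s : 'I_d -> bool, exists2 w, C w &
    forall i : 'I_d, if (i < k)%N then w ord0 i = z ord0 i
                     else a <= (-1) ^+ s i * w ord0 i.
  have [w Cw wz] := H d (leqnn d) (fun=> false).
  suff -> : z = w by [].
  by apply/rowP => i; have := wz i; rewrite ltn_ord.
elim: k => [_ s|k IH kd s].
  by have [w Cw ws] := Cs s; exists w.
pose i0 := Ordinal kd.
pose s' b i := if i == i0 then b else s i.
have [u Cu us] := IH (ltnW kd) (s' false).
have [v Cv vs] := IH (ltnW kd) (s' true).
have ua : a <= u ord0 i0 by have := us i0; rewrite /s' eqxx ltnn expr0 mul1r.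
have va : v ord0 i0 <= - a.
  by have := vs i0; rewrite /s' eqxx ltnn expr1 mulN1r lerNr.
have := za i0; rewrite ler_norml => /andP[z1 z2].
have [t t01 tz] : exists2 t, 0 <= t <= 1 &
    t * u ord0 i0 + (1 - t) * v ord0 i0 = z ord0 i0.
  have [uv|uv] := eqVneq (u ord0 i0) (v ord0 i0).
    by exists 0; [rewrite lexx ler01|lra].
  have vu : 0 < u ord0 i0 - v ord0 i0.
    by rewrite subr_gt0 lt_neqAle eq_sym uv/=; lra.
  exists ((z ord0 i0 - v ord0 i0) / (u ord0 i0 - v ord0 i0)).
    by rewrite divr_ge0 ?ler_pdivrMr ?(ltW vu)//=; lra.
  by field; rewrite gt_eqF.
exists (t *: u + (1 - t) *: v); first exact: cC.
move=> i; have := us i; have := vs i; rewrite !mxE ltnS.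
case: (ltngtP i k) => //= ik.
- move=> -> ->; ring.
- have /negPf ii0 : i != i0 by apply: contraTneq ik => ->; rewrite ltnn.
  rewrite /s' ii0 => h1 h2; move/andP: t01 => [t0 t1].
  have -> : (-1) ^+ s i * (t * u ord0 i + (1 - t) * v ord0 i) =
    t * ((-1) ^+ s i * u ord0 i) + (1 - t) * ((-1) ^+ s i * v ord0 i) by ring.
  have : t * a <= t * ((-1) ^+ s i * u ord0 i) by rewrite ler_wpM2l.
  have : (1 - t) * a <= (1 - t) * ((-1) ^+ s i * v ord0 i).
    by rewrite ler_wpM2l ?subr_ge0.
  lra.
- by have -> : i = i0 by exact: val_inj.
Qed.

Definition corner c (rho : R) (s : {ffun 'I_d -> bool}) : V :=
  \row_i (c ord0 i + (-1) ^+ s i * rho).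

(** The corners need only be met approximately. This is what makes the argument
    usable both for closures of convex sets and for sublevel sets of
    epi-convergent sequences, where points are only controlled up to small
    perturbations. *)
Lemma cvx_corners C c (rho : R) : 0 < rho -> cvx C ->
  (forall s, exists2 w, C w & box (corner c rho s) (rho / 2) w) ->
  box c (rho / 2) `<=` C.
Proof.
move=> r0 cC Cs y cy.
rewrite -(subrK c y).
apply: (@cvx_orthants [set v | C (v + c)] (y - c) (rho / 2)).
- move=> u v t t01 /= Cu Cv.
  rewrite (_ : _ + c = t *: (u + c) + (1 - t) *: (v + c)); first exact: cC.
  by apply/rowP => i; rewrite !mxE; ring.
- by move=> i; have := cy i; rewrite !mxE distrC => /ltW.
- move=> s; have [w Cw sw] := Cs (finfun s).
  exists (w - c) => /=; first by rewrite subrK.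
  move=> i; have := sw i.
  rewrite !mxE ffunE -ball_normE /= ltr_norml => /andP[].
  by case: (s i); rewrite ?expr0 ?expr1; lra.
Qed.

Lemma box_corner c (rho r : R) s : 0 < rho -> rho < r ->
  box c r (corner c rho s).
Proof.
move=> r0 rr i; rewrite -ball_normE /= mxE opprD addrA subrr sub0r normrN.
by rewrite normrM normrX normrN1 expr1n mul1r gtr0_norm.
Qed.

Lemma cvx_closure_interior C : cvx C -> (closure C)° !=set0 -> C° !=set0.
Proof.
move=> cC [c /nbhs_boxP[r r0 rC]]; exists c.
have r20 : 0 < r / 2 by rewrite divr_gt0.
apply/nbhs_boxP; exists (r / 2 / 2); first by rewrite divr_gt0.
apply: cvx_corners => // s; have : closure C (corner c (r / 2) s).
  by apply: rC; apply: box_corner => //; lra.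
move=> /closure_boxP /(_ (r / 2 / 2)).
by rewrite !divr_gt0// => /(_ isT).
Qed.

(** Take x' in C close to x: the image of the cube around y under the
    contraction with centre x' and ratio t lies in C and still covers a
    neighbourhood of the point in question. *)
Lemma cvx_interior_segment C x y (r t : R) : cvx C ->
  closure C x -> 0 < r -> box y r `<=` C -> 0 < t <= 1 ->
  C° ((1 - t) *: x + t *: y).
Proof.
move=> cC /closure_boxP Cx r0 yC /andP[t0 t1].
have tr : 0 < t * r by rewrite mulr_gt0.
apply/nbhs_boxP; exists (t * r / 2); first by rewrite divr_gt0.
move=> z zz; have [x' Cx' xx'] := Cx _ (divr_gt0 tr (ltr0n _ 2)).
pose y' := t^-1 *: (z - (1 - t) *: x').
have -> : z = t *: y' + (1 - t) *: x'.
  by rewrite scalerA divff ?gt_eqF// scale1r subrK.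
apply: cC => //; first by rewrite (ltW t0).
apply: yC => i; have := zz i; have := xx' i.
rewrite -!ball_normE /= !mxE => h1 h2.
rewrite (_ : _ - _ = t^-1 * (((1 - t) * x ord0 i + t * y ord0 i - z ord0 i)
                           + (1 - t) * (x' ord0 i - x ord0 i))); last first.
  by field; rewrite gt_eqF.
rewrite normrM gtr0_norm ?invr_gt0// ltr_pdivrMl//.
rewrite (le_lt_trans (ler_normD _ _))//.
rewrite normrM (@ger0_norm _ (1 - t)) ?subr_ge0// (distrC (x' ord0 i)).
have : (1 - t) * `|x ord0 i - x' ord0 i| <= `|x ord0 i - x' ord0 i|.
  by rewrite -[leRHS]mul1r ler_wpM2r// lerBlDr lerDl ltW.
lra.
Qed.

End boxes.

(** * Epi-convergence *)

(** An ultrafilter that contains all tails decides every predicate; the n-th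
    index is picked in the intersection of the first n decisions. The
    inequality [n <= phi n] lets a decreasing error bound pass to the extracted
    sequence. *)
Lemma sequence_decides (J : countType) (S : J -> nat -> Prop) :
  exists phi : nat -> nat, (forall n, (n <= phi n)%N) /\
    forall j, (\forall n \near \oo, S j (phi n)) \/
              (\forall n \near \oo, ~ S j (phi n)).
Proof.
have [G [GU ooG]] := ultraFilterLemma (@eventually_filter : ProperFilter \oo).
pose D j : set nat := if `[< G (S j) >] then S j else ~` S j.
have GD j : G (D j).
  rewrite /D; case: asboolP => // nGS.
  by have [] := in_ultra_setVsetC (S j) GU.
pose A N : set nat :=
  [set n | (N <= n)%N /\ forall j, (pickle j < N)%N -> D j n].
have GA N : G (A N).
  elim: N => [|N IH]; first by apply: filterS filterT => n _; split.
  have GN : G [set n | (N < n)%N] by apply: ooG; exact: nbhs_infty_gt.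
  case E : (@unpickle J N) => [j0|].
    apply: filterS (filterI GN (filterI IH (GD j0))) => n /= [Nn [[_ h] Dn]].
    split=> // j; rewrite ltnS leq_eqVlt => /orP[/eqP jN|]; last exact: h.
    by move: E; rewrite -jN pickleK => -[->].
  apply: filterS (filterI GN IH) => n /= [Nn [_ h]].
  split=> // j; rewrite ltnS leq_eqVlt => /orP[/eqP jN|]; last exact: h.
  by move: E; rewrite -jN pickleK.
have /choice[phi Aphi] : forall N, exists n, A N n.
  by move=> N; exact: filter_ex (GA N).
exists phi; split=> [n|j]; first by have [] := Aphi n.
have : \forall n \near \oo, D j (phi n).
  exists (pickle j).+1 => // n /= jn.
  by have [_] := Aphi n; apply.
by rewrite /D; case: asboolP => _ h; [left|right].
Qed.

Section epi.
Context {R : realType} {d : nat}.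
Local Notation V := 'rV[R]_d.
Local Open Scope ereal_scope.
Implicit Types (F : nat -> V -> \bar R) (g : V -> \bar R).

Lemma lt_EFin_between (w : R) (x : \bar R) : w%:E < x ->
  exists2 c : R, (w < c)%R & c%:E < x.
Proof.
case: x => [x| |] //; rewrite ?lte_fin => wx.
  by exists ((w + x) / 2)%R; rewrite ?lte_fin; lra.
by exists (w + 1)%R; rewrite ?ltry//; lra.
Qed.

Lemma le_EFinP (x y : \bar R) :
  (forall c : R, c%:E < x -> c%:E <= y) -> x <= y.
Proof.
move=> h; rewrite leNgt; apply/negP => yx.
have [c yc cx] : exists2 c : R, y < c%:E & c%:E < x.
  case: y yx {h} => [y| |].
  - by move=> /lt_EFin_between[c yc cx]; exists c.
  - by rewrite ltNge leey.
  - case: x => [x| |]; last by rewrite ltxx.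
      by move=> _; exists (x - 1)%R; [exact: ltNyr|rewrite lte_fin; lra].
    by move=> _; exists 0%R; [exact: ltNyr|exact: ltry].
by have := h _ cx; rewrite leNgt yc.
Qed.

Lemma limn_einf_ge (u : nat -> \bar R) (l : \bar R) :
  (forall c : R, c%:E < l -> \forall n \near \oo, c%:E <= u n) ->
  l <= limn_einf u.
Proof.
move=> h; apply: le_EFinP => c /h[N _ uN].
rewrite limn_einf_lim; apply: lime_ge; first exact: is_cvg_einfs.
exists N => // m /= Nm; apply: le_ereal_inf_tmp => _ [k /= mk <-].
by apply: uN => /=; exact: leq_trans mk.
Qed.

(** Epi-convergence of F to g: the epigraphs converge in the sense of
    Painleve and Kuratowski. The first clause provides recovery points, the
    second is the lower bound, locally uniform in the argument. *)
Definition epi_cvg F g :=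
  (forall x (a : R) (U : set V), g x < a%:E -> nbhs x U ->
     \forall n \near \oo, exists2 y, U y & F n y < a%:E) /\
  (forall x (c : R), c%:E < g x ->
     exists2 U : set V, nbhs x U &
       \forall n \near \oo, forall y, U y -> c%:E < F n y).

(** Along the subsequence, each inequality between a rational level and the
    infimum over a rational cube is eventually true or eventually false, and
    there are countably many of them. The limit at x is the supremum of the
    levels that eventually bound the sequence from below near x. *)
Lemma epi_compact F : exists phi : nat -> nat, (forall n, (n <= phi n)%N) /\
  exists g, epi_cvg (fun n => F (phi n)) g.
Proof.
pose S (j : ('rV[rat]_d * nat) * rat) n :=
  forall y, qbox j.1 y -> (ratr j.2 : R)%:E < F n y.
have [phi [phi_ge Sphi]] := sequence_decides S.
exists phi; split=> //.
pose A (x : V) : set R := [set q | exists2 U : set V, nbhs x U &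
  \forall n \near \oo, forall y, U y -> q%:E < F (phi n) y].
exists (fun x : V => ereal_sup [set q%:E | q in A x]); split.
- move=> x a U gxa Ux.
  have [p [px pU]] := qbox_base Ux.
  have [q gq qa] : exists2 q : rat, ~ A x (ratr q) & (ratr q < a)%R.
    have [c ac gc] : exists2 c : R, (c < a)%R & ~ A x c.
      apply: contrapT => /forall2NP h.
      have : a%:E <= ereal_sup [set q%:E | q in A x].
        apply: le_EFinP => c; rewrite lte_fin => ca; apply: ereal_sup_ubound.
        by exists c => //; have [|/contrapT] := h c.
      by rewrite leNgt gxa.
    have [q] := rat_in_itvoo ac; rewrite in_itv/= => /andP[cq qa].
    exists q => // -[W Wx WF]; apply: gc; exists W => //.
    apply: filterS WF => n WF y /WF; apply: lt_trans.
    by rewrite lte_fin.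
  have [h|] := Sphi (p, q).
    exfalso; apply: gq; exists (qbox p) => //.
    by apply: open_nbhs_nbhs; split=> //; exact: open_box.
  apply: filterS => n /existsNP[y /not_implyP[py /negP]].
  rewrite -leNgt => Fq; exists y; first exact: pU.
  by rewrite (le_lt_trans Fq)// lte_fin.
- move=> x c /ereal_sup_gt[_ [q [U Ux UF] <-]]; rewrite lte_fin => cq.
  exists U => //; apply: filterS UF => n h y /h.
  by apply: lt_trans; rewrite lte_fin.
Qed.

Section epi_limit.
Variables (F : nat -> V -> \bar R) (g : V -> \bar R).
Hypothesis Fg : epi_cvg F g.
Hypothesis F0 : forall n x, 0 <= F n x.

Lemma epi_lsc : lower_semicontinuous g.
Proof.
move=> x a /lt_EFin_between[c ac cg].
have [U Ux UF] := Fg.2 _ _ cg.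
exists (interior U); first exact: nbhs_interior.
move=> y Uy; rewrite ltNge; apply/negP => ga.
have gc : g y < c%:E by apply: le_lt_trans ga _; rewrite lte_fin.
have [n [[z Uz Fz] h]] := filter_ex (filterI (Fg.1 y c U gc Uy) UF).
by have := h z Uz; rewrite ltNge (ltW Fz).
Qed.

Lemma epi_ge0 x : 0 <= g x.
Proof.
rewrite leNgt; apply/negP => g0.
have [n [y _]] := filter_ex (Fg.1 x 0%R setT g0 filterT).
by rewrite ltNge F0.
Qed.

Lemma epi_le_liminf x : g x <= limn_einf (F ^~ x).
Proof.
apply: limn_einf_ge => c /(Fg.2 _ _)[U Ux]; apply: filterS => n h.
by apply/ltW/h; exact: nbhs_singleton Ux.
Qed.

Hypothesis Fcvx : forall n, econvex (F n).

(** If the inequality failed, recovery points near x and near y would combine to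
    a point near the convex combination at which F is too small. *)
Lemma epi_convex : econvex g.
Proof.
move=> x y t /andP[t0 t1].
have [->|tn0] := eqVneq t 0%R.
  by rewrite scale0r add0r subr0 scale1r mul0e mul1e add0e.
have [->|tn1] := eqVneq t 1%R.
  by rewrite scale1r subrr scale0r addr0 mul0e mul1e adde0.
have tgt0 : (0 < t)%R by rewrite lt_neqAle eq_sym tn0.
have t1gt0 : (0 < 1 - t)%R by rewrite subr_gt0 lt_neqAle tn1.
have := epi_ge0 x; have := epi_ge0 y.
case gx : (g x) => [a| |] //; case gy : (g y) => [b| |] // b0 a0.
- rewrite -!EFinM -EFinD leNgt; apply/negP => /lt_EFin_between[c wc cg].
  pose e := (c - (t * a + (1 - t) * b))%R.
  have e0 : (0 < e)%R by rewrite subr_gt0.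
  have [U /nbhs_boxP[r r0 rU] UF] := Fg.2 _ _ cg.
  have gxa : g x < (a + e)%:E by rewrite gx lte_fin ltrDl.
  have gyb : g y < (b + e)%:E by rewrite gy lte_fin ltrDl.
  have [n [[[x' xx' Fx'] [y' yy' Fy']] h]] := filter_ex (filterI (filterI
    (Fg.1 _ _ _ gxa (nbhs_box x r0)) (Fg.1 _ _ _ gyb (nbhs_box y r0))) UF).
  have : c%:E < c%:E; last by rewrite ltxx.
  have t01 : (0 <= t <= 1)%R by rewrite t0 t1.
  apply: lt_le_trans (h _ (rU _ (box_conv t01 xx' yy'))) _.
  rewrite (le_trans (Fcvx n x' y' t01))//.
  have -> : c%:E = t%:E * (a + e)%:E + (1 - t)%:E * (b + e)%:E.
    by rewrite -!EFinM -EFinD; congr EFin; rewrite /e; ring.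
  by rewrite leeD// lee_wpmul2l ?lee_fin ?ltW.
- by rewrite gt0_muley ?lte_fin// addeC addye ?leey// -EFinM.
- by rewrite gt0_muley ?lte_fin// addye ?leey// -EFinM.
- by rewrite !gt0_muley ?lte_fin// addye ?leey.
Qed.

End epi_limit.
End epi.

(** * Lebesgue measure on R^d *)

Section measureRd.
Context {R : realType} {d : nat}.
Local Notation V := 'rV[R]_d.
Local Notation mu := (lebesgueRd R d).
Local Open Scope ereal_scope.
Implicit Types (A C : set V) (x v c : V) (g : V -> \bar R).

Lemma open_measurableRd A : open A -> measurable (A : set (borelRd R d)).
Proof. exact: sub_sigma_algebra. Qed.

Lemma closed_measurableRd A : closed A -> measurable (A : set (borelRd R d)).
Proof.
move=> cA; rewrite -(setCK A); apply: measurableC.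
exact: (open_measurableRd (closed_openC cA)).
Qed.

Lemma measurable_boxRd x (r : R) : measurable (box x r : set (borelRd R d)).
Proof. by apply: open_measurableRd; exact: open_box. Qed.

Lemma lsc_measurableRd g : lower_semicontinuous g ->
  measurable_fun [set: borelRd R d] (g : borelRd R d -> \bar R).
Proof.
move=> lg; apply: (measurability _ (ErealGenOInfty.measurableE R)).
move=> /= _ [_ [a ->]] <-; rewrite setTI; apply: open_measurableRd.
by rewrite preimage_itvoy; move/lower_semicontinuousP : lg; exact.
Qed.

Lemma lebesgueRd_cube x (r : R) : (0 <= r)%R ->
  mu (box x r) = ((r *+ 2) ^+ d)%:E.
Proof.
move=> r0; rewrite (lebesgueRd_box (A := fun i => ball (x ord0 i) r)).
  under eq_bigr do rewrite lebesgue_measure_ball//.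
  by rewrite prodEFin big_const_ord iter_mulr_1.
by move=> i; exact: measurable_ball.
Qed.

Lemma measurable_translate v : measurable_fun [set: borelRd R d]
  (fun x : borelRd R d => ((x : V) + v)%R : borelRd R d).
Proof.
apply: measurable_row => i; under eq_fun do rewrite mxE.
by apply: measurable_funD => //; exact: measurable_coord.
Qed.

Lemma lebesgue_measure_translate (a : R) (A : set R) : measurable A ->
  @lebesgue_measure R ((fun t => t + a)%R @^-1` A) = lebesgue_measure A.
Proof.
move=> mA.
have mf : measurable_fun [set: measurableTypeR R]
    (fun t : measurableTypeR R => (t + a)%R : measurableTypeR R).
  by apply: measurable_funD.
apply/esym; apply: (@lebesgue_measure_unique R
  (measure_function_pushforward__canonical__measure_function_Measure
    (@lebesgue_measure R) mf)) => // _ [[u v] _ <-] /=.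
rewrite /pushforward (_ : _ @^-1` _ = `]u - a, v - a]%classic)%R.
  rewrite !lebesgue_measure_itv/= !lte_fin ltrD2r; case: ifP => // _.
  by rewrite !EFinN -!EFinD; congr EFin; ring.
by apply/seteqP; split => t /=; rewrite !in_itv/= ltrBlDr lerBrDr.
Qed.

Let boxes : set (set V) := [set B | exists2 A : 'I_d -> set R,
  (forall i, measurable (A i)) & B = [set v : V | forall i, A i (v ord0 i)]].

Let measurable_boxes : @measurable _ (borelRd R d) = <<s boxes >>.
Proof.
apply/seteqP; split.
- apply: smallest_sub; first exact: smallest_sigma_algebra.
  move=> U oU.
  have -> : U = \bigcup_(p : 'rV[rat]_d * nat)
      (if `[< qbox p `<=` U >] then (qbox p : set V) else set0).
    apply/seteqP; split => [x Ux|x [p _]]; last first.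
      by case: ifPn => // /asboolP BU /BU.
    have [p [px pU]] := qbox_base (open_nbhs_nbhs (conj oU Ux)).
    by exists p => //; case: asboolP.
  apply: (@countable_bigcupT_measurable _ (g_sigma_algebraType boxes)) => [|p].
    exact: countableP.
  case: ifPn => _; last exact: measurable0.
  apply: sub_sigma_algebra.
  exists (fun i => ball (map_mx ratr p.1 ord0 i : R) p.2.+1%:R^-1)%R => //.
  by move=> i; exact: measurable_ball.
- apply: smallest_sub; first exact: smallest_sigma_algebra.
  by move=> _ [A mA ->]; exact: measurable_box.
Qed.

(** Both sides are measures in A that agree on products of measurable sets,
    which form a generating system stable under intersection. *)
Lemma lebesgueRd_translate v (A : set V) : measurable (A : set (borelRd R d)) ->
  mu ((fun x => x + v)%R @^-1` A) = mu A.
Proof.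
move=> mA; pose m2 : {measure set (borelRd R d) -> \bar R} :=
  measure_function_pushforward__canonical__measure_function_Measure
    mu (measurable_translate v).
apply/esym; change (mu A = m2 A).
apply: (@measure_unique _ R (borelRd R d) boxes (fun n => box (0%R : V) n%:R)
  measurable_boxes _ _ _ mu m2) => //.
- move=> _ _ [A1 mA1 ->] [A2 mA2 ->]; exists (fun i => A1 i `&` A2 i).
    by move=> i; exact: measurableI.
  apply/seteqP; split => [x [h1 h2] i|x h].
    by split; [exact: h1|exact: h2].
  by split => i; have [] := h i.
- move=> n; exists (fun i => ball ((0%R : V) ord0 i) n%:R) => // i.
  exact: measurable_ball.
- apply/seteqP; split => // x _.
  exists (Num.truncn (\sum_(i < d) `|x ord0 i|)%R).+1 => // i.
  rewrite -ball_normE /= mxE sub0r normrN.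
  apply: le_lt_trans (truncnS_gt _).
  by rewrite (bigD1 i)//= lerDl sumr_ge0.
- move=> _ [B mB ->]; rewrite /= /pushforward.
  have -> : (fun x => x + v)%R @^-1` [set x : V | forall i, B i (x ord0 i)] =
      [set x : V | forall i, ((fun t => t + v ord0 i)%R @^-1` B i) (x ord0 i)].
    by apply/seteqP; split => x h i; have := h i; rewrite /= mxE.
  have mBi i : measurable ((fun t => t + v ord0 i)%R @^-1` B i).
    rewrite -[X in measurable X]setTI.
    by apply: (@measurable_funD _ _ _ _ id (cst (v ord0 i))) => //; exact: mB.
  rewrite (lebesgueRd_box mB) (lebesgueRd_box mBi); apply: eq_bigr => i _.
  exact/esym/lebesgue_measure_translate.
- move=> n; suff : mu (box (0%R : V) n%:R) < +oo by [].
  by rewrite lebesgueRd_cube// ltry.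
Qed.

End measureRd.

Section boundary.
Context {R : realType} {d : nat}.
Local Notation V := 'rV[R]_d.
Local Notation mu := (lebesgueRd R d).
Local Open Scope ereal_scope.
Implicit Types (A C : set V) (x v c : V) (g : V -> \bar R).

(** Infinitely many pairwise disjoint translates of A, all of the same measure,
    fit in a cube. *)
Lemma disjoint_translates_null A v q (r : R) :
  measurable (A : set (borelRd R d)) -> (0 < r)%R -> A `<=` box q r ->
  (forall x (t : R), A x -> (0 < t <= 1)%R -> ~ A (x + t *: v)%R) ->
  mu A = 0.
Proof.
move=> mA r0 Ar Av.
(* the k-th translate is A + v / (k + 1) *)
pose F (k : nat) : set (borelRd R d) :=
  (fun x : V => (x - k.+1%:R^-1 *: v)%R) @^-1` A.
have mF k : measurable (F k).
  rewrite -[X in measurable X]setTI.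
  exact: (measurable_translate (- (k.+1%:R^-1 *: v))%R).
have muF k : mu (F k) = mu A.
  exact: (lebesgueRd_translate (- (k.+1%:R^-1 *: v))%R).
have tF : trivIset setT F.
  apply/trivIsetP => i j _ _ ij.
  wlog ij' : i j ij / (i < j)%N.
    move=> h; have [ij'|ij'] := ltnP i j; first exact: h.
    rewrite setIC; apply: h; first by rewrite eq_sym.
    by rewrite ltn_neqAle eq_sym ij.
  apply/seteqP; split => // x [/= Ai Aj].
  have tlt : (j.+1%:R^-1 < i.+1%:R^-1 :> R)%R.
    by rewrite ltf_pV2 ?posrE// ltr_nat ltnS.
  apply: (Av _ (i.+1%:R^-1 - j.+1%:R^-1)%R Ai).
    rewrite subr_gt0 tlt/= lerBlDr (@le_trans _ _ 1%R)//.
      by rewrite invf_le1// ler1n.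
    by rewrite lerDl invr_ge0.
  by rewrite scalerBl addrA subrK.
pose M : R := (r + \sum_(i < d) `|v ord0 i|)%R.
have FM : \bigcup_k F k `<=` box q M.
  move=> x [k _ /Ar h] i; have := h i; rewrite -!ball_normE /= !mxE => hi.
  have -> : (q ord0 i - x ord0 i =
      (q ord0 i - (x ord0 i - k.+1%:R^-1 * v ord0 i))
      - k.+1%:R^-1 * v ord0 i)%R by ring.
  rewrite (le_lt_trans (ler_normB _ _))// ltr_leD// normrM.
  rewrite (bigD1 i)//= ler_wpDr ?sumr_ge0//.
  rewrite -[leRHS]mul1r ler_wpM2r// ger0_norm ?invr_ge0//.
  by rewrite invf_le1// ler1n.
have sumF n : n%:R%:E * mu A <= mu (box q M).
  apply: le_trans (_ : mu (\bigcup_k F k) <= _); last first.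
    rewrite le_measure ?inE//; first exact: bigcup_measurable.
    exact: measurable_boxRd.
  rewrite measure_semi_bigcup//; last exact: bigcup_measurable.
  apply: le_trans (nneseries_lim_ge n _); last by [].
  elim: n => [|n IH]; first by rewrite mul0e big_nil.
  rewrite big_nat_recr//= -natr1 EFinD ge0_muleDl ?lee_fin// mul1e.
  by apply: leeD => //; rewrite -(muF n).
have M0 : (0 <= M)%R by rewrite addr_ge0 ?sumr_ge0// ltW.
have := measure_ge0 mu A; rewrite le_eqVlt => /orP[/eqP <-//|muA].
have muAfin : mu A \is a fin_num.
  rewrite ge0_fin_numE//; have := sumF 1%N; rewrite mul1e => h.
  by apply: le_lt_trans h _; rewrite lebesgueRd_cube// ltry.
have e0 : (0 < fine (mu A))%R by rewrite fine_gt0// muA ltey_eq muAfin.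
have := sumF (Num.truncn ((M *+ 2) ^+ d / fine (mu A))%R).+1.
rewrite lebesgueRd_cube// -[X in _ * X]fineK// -EFinM lee_fin leNgt.
by rewrite -ltr_pdivrMr// truncnS_gt.
Qed.

(** From a boundary point, a small motion towards an interior point leads into
    the interior. Near a given point q one direction serves for all boundary
    points, namely [c - q] for the centre c of a cube inside C, so that the
    translates of that piece of the boundary along it are disjoint. *)
Lemma cvx_boundary_null C : cvx C -> C° !=set0 ->
  mu.-negligible (closure C `\` C°).
Proof.
move=> cC [c /nbhs_boxP[r r0 rC]].
pose E (p : 'rV[rat]_d) : set V :=
  (closure C `\` C°) `&` box (map_mx ratr p) r.
have mE p : measurable (E p : set (borelRd R d)).
  apply: measurableI; last exact: measurable_boxRd.
  apply: measurableD.
    by apply: closed_measurableRd; exact: closed_closure.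
  by apply: open_measurableRd; exact: open_interior.
have E0 p : mu (E p) = 0.
  set q : V := map_mx ratr p.
  apply: (@disjoint_translates_null _ (c - q)%R q r (mE p) r0).
    by move=> x [].
  move=> x t [[Cx _] qx] t01 [[_ nC] _]; apply: nC.
  have cx : box c r (c + (x - q))%R.
    move=> i; have := qx i; rewrite -!ball_normE /= !mxE.
    by rewrite opprD addrA subrr sub0r normrN distrC.
  have /nbhs_boxP[e e0 eC] := open_nbhs_nbhs (conj (@open_box _ _ c r) cx).
  rewrite (_ : _ + _ = (1 - t) *: x + t *: (c + (x - q)))%R.
    exact: (cvx_interior_segment cC Cx e0 (subset_trans eC rC) t01).
  by apply/rowP => i; rewrite !mxE; ring.
pose UE : set (borelRd R d) := \bigcup_k
    (if @unpickle 'rV[rat]_d k is Some p then E p else set0).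
apply: (@negligibleS _ _ _ mu UE).
  move=> x Cx; have [[p n] [/= px pr]] := qbox_base (nbhs_box x r0).
  exists (pickle p) => //; rewrite pickleK; split=> //.
  by apply/box_sym/pr => i; exact/ballxx.
apply: negligible_bigcup => k.
case: unpickle => [p|]; last exact: negligible_set0.
by exists (E p); split => //; exact: E0.
Qed.

End boundary.

(** * Negative powers of extended real numbers *)

Section npower.
Context {R : realType}.
Implicit Types (x y a b c p : R) (u : \bar R).

Lemma powR_le_neg x y p : 0 < x -> x <= y -> p <= 0 -> y `^ p <= x `^ p.
Proof.
move=> x0 xy p0; have y0 := lt_le_trans x0 xy.
rewrite -[p]opprK (powRN x) (powRN y) lef_pV2 ?posrE ?powR_gt0//.
by rewrite ge0_ler_powR ?nnegrE ?oppr_ge0// ltW.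
Qed.

Lemma powR_invK c p : 0 < c -> p != 0 -> (c `^ p^-1) `^ p = c.
Proof. by move=> c0 p0; rewrite -powRrM mulVf// powRr1// ltW. Qed.

(** The graph of y^p lies above its tangent line at b. After division by b^p
    this is Bernoulli's inequality, which follows from two uses of
    1 + t <= exp t. *)
Lemma powR_tangent a b p : 0 < a -> 0 < b -> p <= 0 ->
  b `^ p + p * b `^ (p - 1) * (a - b) <= a `^ p.
Proof.
move=> a0 b0 p0.
have bp : b `^ p = b `^ (p - 1) * b.
  have := @powRD _ b (p - 1) 1; rewrite subrK (gt_eqF b0) implybT => ->//.
  by rewrite powRr1// ltW.
have -> : b `^ p + p * b `^ (p - 1) * (a - b) = b `^ p * (1 + p * (a / b - 1)).
  by rewrite bp; field; rewrite gt_eqF.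
have u0 : 0 < a / b by rewrite divr_gt0.
have -> : a `^ p = b `^ p * (a / b) `^ p.
  rewrite -powRM ?ltW//; congr (_ `^ _); field; by rewrite gt_eqF.
rewrite ler_wpM2l ?powR_ge0//.
rewrite /powR gt_eqF//; apply: le_trans (expR_ge1Dx _).
rewrite lerD2l ler_wnM2l// lerBrDl.
by apply: le_trans (expR_ge1Dx (ln (a / b))) _; rewrite lnK.
Qed.

Local Open Scope ereal_scope.

Lemma npoweR_ge0 u p : 0 <= npoweR u p.
Proof.
by case: u => [a| |] //=; case: ifP => // _; rewrite lee_fin powR_ge0.
Qed.

Lemma npoweR_gt0E a p : (0 < a)%R -> npoweR a%:E p = (a `^ p)%:E.
Proof. by move=> a0 /=; rewrite gt_eqF. Qed.

Lemma npoweR_le u v p : (p <= 0)%R -> 0 <= u -> u <= v ->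
  npoweR v p <= npoweR u p.
Proof.
move=> p0; case: u => [a| |] //; case: v => [b| |] // a0 ab.
- rewrite lee_fin in a0; rewrite lee_fin in ab.
  have [->|an0] := eqVneq a 0%R; first by rewrite /= eqxx leey.
  have agt0 : (0 < a)%R by rewrite lt_neqAle eq_sym an0.
  by rewrite !npoweR_gt0E ?(lt_le_trans agt0)// lee_fin powR_le_neg.
- exact: npoweR_ge0.
Qed.

Lemma npoweRE p : (fun u : \bar R => npoweR u p) = fun u =>
  if u == 0 then +oo else
  if u \is a fin_num then (fine u `^ p)%:E else 0.
Proof. by apply/funext => -[a| |]. Qed.

Lemma measurable_npoweR p : measurable_fun [set: \bar R] (fun u => npoweR u p).
Proof.
rewrite npoweRE; apply: measurable_fun_ifT => //.
  exact: measurable_fun_eqe.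
apply: measurable_fun_ifT => //=.
  apply: (measurable_fun_bool true).
  rewrite setTI (_ : _ @^-1` _ = EFin @` setT).
    by apply: measurable_image_EFin; exact: measurableT.
  apply/seteqP; split => [x finx|x [s sx <-//]]/=.
  by exists (fine x) => //; rewrite fineK.
apply/measurable_EFinP => //=.
exact: (@measurableT_comp _ _ _ _ _ _ (@powR R ^~ p)).
Qed.

(** An upper bound on the upper limit of w becomes a lower bound on the lower
    limit of its negative powers; the values 0 and +oo of u are included. *)
Lemma npoweR_liminf (w : nat -> \bar R) u p : (p < 0)%R -> 0 <= u ->
  (forall n, 0 <= w n) ->
  (forall a : R, u < a%:E -> \forall n \near \oo, w n < a%:E) ->
  npoweR u p <= limn_einf (fun n => npoweR (w n) p).
Proof.
move=> p0 u0 w0 uw; apply: limn_einf_ge => c cu.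
have [c0|c0] := ltP c 0%R.
  by apply: nearW => n; apply: le_trans (npoweR_ge0 _ _); rewrite lee_fin ltW.
have [c' cc' c'u] := lt_EFin_between cu.
have c'0 := le_lt_trans c0 cc'.
have pn0 : p != 0%R by rewrite lt_eqF.
set a := (c' `^ p^-1)%R.
have a0 : (0 < a)%R by exact: powR_gt0.
have ac' : npoweR a%:E p = c'%:E by rewrite npoweR_gt0E// powR_invK.
have ua : u < a%:E.
  rewrite ltNge; apply/negP => /(npoweR_le (ltW p0)).
  rewrite lee_fin => /(_ (ltW a0)).
  by rewrite ac' leNgt c'u.
apply: filterS (uw _ ua) => n wa.
apply: le_trans (npoweR_le (ltW p0) (w0 n) (ltW wa)).
by rewrite ac' lee_fin ltW.
Qed.

End npower.

Section npower_shift.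
Context {R : realType}.
Implicit Types (p e k u c : R) (y : \bar R).
Local Open Scope ereal_scope.

Lemma npoweR_scale k y p : (0 < k)%R -> 0 < y ->
  npoweR (k%:E * y) p = (k `^ p)%:E * npoweR y p.
Proof.
move=> k0; case: y => [a| |] //; last by rewrite gt0_muley ?lte_fin// mule0.
rewrite lte_fin => a0; rewrite -EFinM !npoweR_gt0E ?mulr_gt0// -EFinM.
by rewrite powRM ?ltW.
Qed.

Lemma npoweR_tangent_above y e b : (0 < e)%R -> (b < 0)%R -> 0 < y ->
  npoweR (y + e%:E) b + (`|b| * e)%:E * npoweR (y + e%:E) (b - 1)%R <=
  npoweR y b.
Proof.
move=> e0 b0; case: y => [a| |] //; last by rewrite addye//= mule0 adde0.
rewrite lte_fin => a0; have ae0 : (0 < a + e)%R by rewrite addr_gt0.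
rewrite -EFinD !npoweR_gt0E// -EFinM -EFinD lee_fin.
apply: le_trans (powR_tangent a0 ae0 (ltW b0)); rewrite ltr0_norm//.
lra.
Qed.

Lemma npoweR_tangent_below y e b : (0 < e)%R -> (b < 0)%R -> 0 < y ->
  npoweR y b <= npoweR (y + e%:E) b + (`|b| * e)%:E * npoweR y (b - 1)%R.
Proof.
move=> e0 b0; case: y => [a| |] //; last by rewrite addye//= mule0 adde0.
rewrite lte_fin => a0; have ae0 : (0 < a + e)%R by rewrite addr_gt0.
rewrite -EFinD !npoweR_gt0E// -EFinM -EFinD lee_fin.
have := powR_tangent ae0 a0 (ltW b0); rewrite (ltr0_norm b0).
by rewrite (addrC a) addrK; lra.
Qed.

(** Let u tend to 1; the tangent line 1 + p (u - 1) of u^p makes this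
    explicit. *)
Lemma eq1_of_powR_bounds p (I : R) : (p < 0)%R ->
  (forall u, (1 < u)%R -> (u `^ p * I <= 1)%R /\ (u `^ p <= I)%R) -> I = 1%R.
Proof.
move=> p0 h.
have bern u : (1 < u)%R -> (1 + p * (u - 1) <= u `^ p)%R.
  move=> u1; have := powR_tangent (lt_trans ltr01 u1) ltr01 (ltW p0).
  by rewrite !powR1 mulr1.
have I0 : (0 < I)%R.
  have [_] := h 2%R (ltr1n _ 2); apply: lt_le_trans; exact: powR_gt0.
apply/eqP; rewrite eq_le; apply/andP; split.
- rewrite leNgt; apply/negP => I1.
  pose u : R := (1 + (I - 1) / (2 * I * - p))%R.
  have den : (0 < 2 * I * - p)%R by rewrite !mulr_gt0 ?oppr_gt0.
  have u1 : (1 < u)%R by rewrite ltrDl divr_gt0 ?subr_gt0.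
  have [+ _] := h u u1; have := bern u u1.
  rewrite -(ler_pM2r I0) => h1 /(le_trans h1).
  have -> : ((1 + p * (u - 1)) * I = (I + 1) / 2)%R.
    by rewrite /u; field; rewrite lt_eqF// gt_eqF.
  lra.
- rewrite leNgt; apply/negP => I1.
  pose u : R := (1 + (1 - I) / (2 * - p))%R.
  have den : (0 < 2 * - p)%R by rewrite !mulr_gt0 ?oppr_gt0.
  have u1 : (1 < u)%R by rewrite ltrDl divr_gt0 ?subr_gt0.
  have [_] := h u u1; have := bern u u1.
  have -> : ((1 + p * (u - 1)) = (I + 1) / 2)%R.
    by rewrite /u; field; rewrite lt_eqF.
  lra.
Qed.

End npower_shift.

(** * A competitor of finite value *)

Section integrability.
Context {R : realType} {d : nat}.
Local Notation V := 'rV[R]_d.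
Local Notation mu := (lebesgueRd R d).
Local Open Scope ereal_scope.
Implicit Types x : V.

Definition norm1 (x : V) : R := (\sum_(i < d) (`|x ord0 i| : R))%R.

Lemma norm1_ge0 x : (0 <= norm1 x)%R.
Proof. exact: sumr_ge0. Qed.

Lemma norm1_box x r : (norm1 x < r)%R -> box 0%R r x.
Proof.
move=> xr i; rewrite -ball_normE /= mxE sub0r normrN (le_lt_trans _ xr)//.
by rewrite /norm1 (bigD1 i)//= lerDl sumr_ge0.
Qed.

Lemma norm1_continuous : continuous norm1.
Proof.
have cN (i : 'I_d) : continuous (fun y : V => `|y ord0 i| : R)%R.
  move=> x.
  have := @cvg_norm R R^o V (nbhs x) _ (fun y : V => y ord0 i) (x ord0 i)
    (@coord_continuous R 1 d ord0 i x).
  exact.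
rewrite /norm1; elim: (index_enum _) => [|i s IH].
  rewrite (_ : (fun _ => _) = cst 0%R); first exact: cst_continuous.
  by apply/funext => y; rewrite big_nil.
rewrite (_ : (fun _ => _) = ((fun y : V => `|y ord0 i| : R) \+
    (fun y : V => \sum_(j <- s) (`|y ord0 j| : R)))%R); last first.
  by apply/funext => y; rewrite big_cons.
by move=> x; have := @cvgD R R^o V (nbhs x) _ _ _ _ _ (cN i x) (IH x); exact.
Qed.

Lemma measurable_npoweR_lsc (g : V -> \bar R) b : lower_semicontinuous g ->
  measurable_fun [set: borelRd R d] (fun x : borelRd R d => npoweR (g x) b).
Proof.
move=> gl; apply: (measurableT_comp (measurable_npoweR b)).
exact: lsc_measurableRd.
Qed.

Lemma measurable_norm1 :
  measurable_fun [set: borelRd R d] (fun x : borelRd R d => norm1 (x : V)).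
Proof.
rewrite /norm1; apply: measurable_sum => i.
by apply: measurableT_comp => //; exact: measurable_coord.
Qed.

(** Dyadic decomposition: where 2^n <= 1 + |x|_1 < 2^(n+1), the integrand is at
    most (2^b)^n and x lies in a cube of volume (4 * 2^n)^d. The resulting
    geometric series has ratio 2^(b + d) < 1. *)
Lemma integral_norm1_lt (b : R) : (b < - d%:R)%R ->
  \int[mu]_x npoweR (1 + norm1 x)%:E b < +oo.
Proof.
move=> bd.
have b0 : (b < 0)%R by apply: lt_le_trans bd _; rewrite oppr_le0.
have mnp : measurable_fun [set: borelRd R d]
    (fun x : borelRd R d => npoweR (1 + norm1 x)%:E b).
  apply: (measurableT_comp (measurable_npoweR b)).
  apply/measurable_EFinP; apply: measurable_funD => //.
  exact: measurable_norm1.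
pose f (n : nat) (x : borelRd R d) : \bar R :=
  ((2 `^ b) ^+ n)%:E * (\1_(box (0%R : V) (2 ^+ n.+1)) x)%:E.
have f0 n x : 0 <= f n x by rewrite mule_ge0// ?lee_fin ?exprn_ge0 ?powR_ge0.
have mf n : measurable_fun [set: borelRd R d] (f n).
  apply: emeasurable_funM => //; apply/measurable_EFinP/measurable_indic.
  exact: measurable_boxRd.
have le_f x : npoweR (1 + norm1 x)%:E b <= \sum_(n <oo) f n x.
  have x1 : (0 < 1 + norm1 x)%R by rewrite ltr_wpDr// norm1_ge0.
  have ex : exists n, (1 + norm1 x < 2 ^+ n.+1)%R.
    exists (Num.truncn (1 + norm1 x)%R).
    apply: lt_le_trans (truncnS_gt _) _.
    by rewrite -natrX ler_nat ltnW// ltn_expl.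
  case: (ex_minnP ex) => n xn nmin.
  have nx : (2 ^+ n <= 1 + norm1 x)%R.
    case: n xn nmin => [_ _|n xn nmin]; first by rewrite expr0 lerDl norm1_ge0.
    by rewrite leNgt; apply/negP => /nmin; rewrite ltnn.
  apply: le_trans (nneseries_lim_ge n.+1 _); last by move=> k _ _; exact: f0.
  rewrite big_nat_recr//; apply: le_trans (leeDr _ _); last exact: sume_ge0.
  rewrite npoweR_gt0E// /f indicE mem_set ?mule1; last first.
    by apply: norm1_box; apply: le_lt_trans xn; rewrite lerDr.
  rewrite lee_fin.
  rewrite -powR_mulrn ?powR_ge0// -powRrM mulrC powRrM powR_mulrn//.
  by apply: powR_le_neg => //; rewrite ?exprn_gt0// ltW.
apply: (@le_lt_trans _ _ (\int[mu]_x \sum_(n <oo) f n x)).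
  apply: ge0_le_integral => //.
  - by move=> x _; exact: npoweR_ge0.
  - by apply: ge0_emeasurable_sum.
rewrite integral_nneseries//.
have q1 : (2 `^ b * 2 ^+ d < 1 :> R)%R.
  rewrite -powR_mulrn// -powRD ?pnatr_eq0 ?implybT//.
  rewrite /powR pnatr_eq0/= -[ltRHS]expR0 ltr_expR nmulr_rlt0.
    by rewrite ln_gt0// ltr1n.
  by rewrite -ltrBrDr sub0r.
have int_f n : \int[mu]_x f n x = (geometric (4 ^+ d) (2 `^ b * 2 ^+ d) n)%:E.
  rewrite ge0_integralZl//; last first.
    by apply/measurable_EFinP/measurable_indic; exact: measurable_boxRd.
  rewrite integral_indic//; last exact: measurable_boxRd.
  rewrite setIT [X in _ * X](@lebesgueRd_cube R d 0%R (2 ^+ n.+1)) ?exprn_ge0//.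
  rewrite -EFinM /geometric /=; congr EFin.
  have -> : (2 ^+ n.+1 *+ 2 = 4 * 2 ^+ n :> R)%R by rewrite exprS; ring.
  by rewrite !exprMn exprAC; ring.
under eq_eseriesr do rewrite int_f.
rewrite (_ : \sum_(n <oo) _ =
  (limn (series (geometric (4 ^+ d : R) (2 `^ b * 2 ^+ d))))%:E) ?ltry//.
have q0 : (0 <= 2 `^ b * 2 ^+ d :> R)%R.
  by rewrite mulr_ge0 ?powR_ge0// exprn_ge0.
rewrite -EFin_lim; last by apply: is_cvg_geometric_series; rewrite ger0_norm.
by congr (limn _); apply/funext => n /=; rewrite sumEFin.
Qed.
End integrability.

Lemma exponent_lt (R : realType) (d : nat) (s : R) :
  - (d.+1%:R)^-1 < s -> s < 0 -> 1 + s^-1 < - d%:R.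
Proof.
move=> s1 s0; have : s^-1 < - d.+1%:R.
  have -> : - d.+1%:R = (- (d.+1%:R)^-1)^-1 :> R by rewrite invrN invrK.
  by rewrite ltf_nV2 ?negrE ?oppr_lt0 ?invr_gt0.
by rewrite -natr1; lra.
Qed.

Section candidate.
Context {R : realType} {d : nat}.
Local Notation V := 'rV[R]_d.
Local Notation mu := (lebesgueRd R d).
Implicit Types (x y : V) (g : V -> \bar R) (Q : probability (borelRd R d) R).

Lemma enorm_le_norm1 x : enorm x <= norm1 x.
Proof.
rewrite /enorm -[leRHS]ger0_norm ?norm1_ge0// -sqrtr_sqr ler_wsqrtr//.
rewrite expr2 [X in _ <= X * _]/norm1 mulr_suml ler_sum// => i _.
rewrite -real_normK ?num_real// expr2 ler_wpM2l//.
by rewrite /norm1 (bigD1 i)//= lerDl sumr_ge0.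
Qed.

Lemma norm1_le_enorm x : norm1 x <= d%:R * enorm x.
Proof.
rewrite mulr_natl -[X in _ *+ X]card_ord -sumr_const ler_sum// => i _.
rewrite -sqrtr_sqr /enorm ler_wsqrtr// (bigD1 i)//= lerDl.
by apply: sumr_ge0 => j _; exact: sqr_ge0.
Qed.

Local Open Scope ereal_scope.

Definition one_plus_norm1 x : \bar R := (1 + norm1 x)%:E.

Lemma classG_one_plus_norm1 : classG one_plus_norm1.
Proof.
split.
- by move=> x; rewrite lee_fin addr_ge0// norm1_ge0.
- move=> x a; rewrite lte_fin -ltrBlDl => ax.
  exists [set y | a - 1 < norm1 y]%R.
    exact: (norm1_continuous (lt_nbhsr ax)).
  by move=> y /=; rewrite lte_fin -ltrBlDl.
- move=> x y t /andP[t0 t1]; rewrite /one_plus_norm1 -!EFinM -EFinD lee_fin.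
  have -> : (t * (1 + norm1 x) + (1 - t) * (1 + norm1 y) =
    1 + (t * norm1 x + (1 - t) * norm1 y))%R by ring.
  rewrite lerD2l /norm1 !mulr_sumr -big_split/= ler_sum// => i _.
  rewrite !mxE (le_trans (ler_normD _ _))// !normrM (ger0_norm t0).
  by rewrite (@ger0_norm _ (1 - t)%R) ?subr_ge0.
- exists 0%R; apply/nbhs_boxP; exists 1%R => // x _; exact: ltry.
- move=> M; exists M => x Mx; rewrite lee_fin.
  rewrite (le_trans (ltW Mx))// (le_trans (enorm_le_norm1 x))//.
  by rewrite lerDr.
Qed.

Lemma measurable_enorm :
  measurable_fun [set: borelRd R d] (fun x : borelRd R d => enorm (x : V)).
Proof.
apply: (measurableT_comp (continuous_measurable_fun (@sqrt_continuous R))).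
apply: measurable_sum => i; apply: measurable_funX; exact: measurable_coord.
Qed.

Lemma Ls_one_plus_norm1 s Q : (- (d.+1%:R)^-1 < s)%R -> (s < 0)%R ->
  classQ1 Q -> Ls s one_plus_norm1 Q < +oo.
Proof.
move=> s1 s0 Q1; rewrite /Ls; apply: lte_add_pinfty.
  rewrite /one_plus_norm1; under eq_integral do rewrite EFinD.
  rewrite ge0_integralD//; last 2 first.
  - by move=> x _; rewrite lee_fin norm1_ge0.
  - apply/measurable_EFinP; exact: measurable_norm1.
  apply: lte_add_pinfty.
    by rewrite integral_cst// mul1e (le_lt_trans (probability_le1 _ _))// ltry.
  apply: (@le_lt_trans _ _ (\int[Q]_x (d%:R%:E * (enorm x)%:E))).
    apply: ge0_le_integral => //.
    - by move=> x _; rewrite lee_fin norm1_ge0.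
    - by apply/measurable_EFinP; exact: measurable_norm1.
    - apply: measurable_funeM; apply/measurable_EFinP.
      exact: measurable_enorm.
    - by move=> x _; rewrite -EFinM lee_fin norm1_le_enorm.
  rewrite ge0_integralZl//; last 2 first.
  - by apply/measurable_EFinP; exact: measurable_enorm.
  - by move=> x _; rewrite lee_fin sqrtr_ge0.
  by rewrite lte_mul_pinfty.
apply: lte_mul_pinfty => //; apply: integral_norm1_lt.
exact: exponent_lt.
Qed.

End candidate.

(** * Domains and epi-limits of convex functions *)

Section convex_functions.
Context {R : realType} {d : nat}.
Local Notation V := 'rV[R]_d.
Local Notation mu := (lebesgueRd R d).
Local Open Scope ereal_scope.
Implicit Types (x y : V) (g : V -> \bar R) (Q : probability (borelRd R d) R).

Lemma sublevel_cvx g (M : R) : econvex g -> cvx [set x | g x <= M%:E].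
Proof.
move=> cg x y t t01 /= gx gy; apply: le_trans (cg x y t t01) _.
have -> : M%:E = t%:E * M%:E + (1 - t)%:E * M%:E.
  by rewrite -!EFinM -EFinD; congr EFin; ring.
by case/andP: t01 => t0 t1; rewrite leeD// lee_wpmul2l// lee_fin ?subr_ge0.
Qed.

Lemma edom_cvx g : (forall x, 0 <= g x) -> econvex g -> cvx (edom g).
Proof.
move=> g0 cg x y t t01 gx gy; apply: le_lt_trans (cg x y t t01) _.
case/andP: t01 => t0 t1.
by apply: lte_add_pinfty; apply: lte_mul_pinfty; rewrite ?lee_fin ?subr_ge0.
Qed.

(** The closure of the domain is a closed convex set of full measure, so it
    contains the convex support of Q. *)
Lemma edom_interior g Q : (forall x, 0 <= g x) -> econvex g ->
  lower_semicontinuous g -> classQ0 Q -> \int[Q]_x g x < +oo ->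
  (edom g)° !=set0.
Proof.
move=> g0 cg lg [c csc] Qg; apply: (cvx_closure_interior (edom_cvx g0 cg)).
exists c; apply: filterS csc => x; apply.
have cvc := closure_cvx (edom_cvx g0 cg).
split; [exact: closed_closure|exact: cvx_convex_set|].
have mcl : measurable (closure (edom g) : set (borelRd R d)).
  by apply: closed_measurableRd; exact: closed_closure.
have ig : Q.-integrable [set: borelRd R d] (g : borelRd R d -> \bar R).
  apply/integrableP; split; first exact: lsc_measurableRd.
  by under eq_integral do rewrite gee0_abs//.
have [N [mN QN gN]] := integrable_ae measurableT ig.
rewrite -[X in Q X]setCK probability_setC; last exact: measurableC.
suff -> : Q (~` closure (edom g)) = 0 by rewrite sube0.
apply/eqP; rewrite -measure_le0 -QN le_measure ?inE//; first exact: measurableC.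
move=> y ny; apply: gN => /= /(_ I) gy; apply: ny; apply: subset_closure.
by rewrite /edom /= ltey_eq gy.
Qed.

Section recovery.
Variables (F : nat -> V -> \bar R) (g : V -> \bar R).
Hypothesis Fg : forall x (a : R) (U : set V), g x < a%:E -> nbhs x U ->
  \forall n \near \oo, exists2 y, U y & F n y < a%:E.
Hypothesis g0 : forall x, 0 <= g x.
Hypothesis Fcvx : forall n, econvex (F n).

(** Recovery points near the corners of a small cube bound the convex functions
    F n on the half cube. *)
Lemma epi_locally_bounded x : (edom g)° x -> exists2 r : R, (0 < r)%R &
  exists M : R, \forall n \near \oo, forall y, box x r y -> F n y <= M%:E.
Proof.
move=> /nbhs_boxP[r r0 rg]; pose rho : R := (r / 2)%R.
have rho0 : (0 < rho)%R by rewrite divr_gt0.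
exists (rho / 2)%R; first by rewrite divr_gt0.
pose M : R := (\sum_(s : {ffun 'I_d -> bool}) fine (g (corner x rho s)) + 1)%R.
exists M.
have gM s : g (corner x rho s) < M%:E.
  have : edom g (corner x rho s).
    by apply/rg/box_corner => //; rewrite /rho; lra.
  rewrite /edom /= ltey_eq => /orP[gfin|/eqP E]; last first.
    by have := g0 (corner x rho s); rewrite E.
  rewrite -(fineK gfin) lte_fin /M (bigD1 s)//= -addrA ltrDl.
  by rewrite ltr_wpDl// sumr_ge0// => i _; exact: fine_ge0.
have h : \forall n \near \oo, forall s,
    exists2 y, box (corner x rho s) (rho / 2) y & F n y < M%:E.
  apply: filter_forall => s; apply: (Fg (gM s)); apply: nbhs_box.
  by rewrite divr_gt0.
apply: filterS h => n h.
apply: (cvx_corners rho0 (sublevel_cvx (M := M) (Fcvx n))) => s.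
by have [y yb yM] := h s; exists y => //=; exact: ltW.
Qed.

(** Write x as a convex combination of a recovery point y very close to x and a
    point z of the cube where F n <= M, with small weight t on z. *)
Lemma epi_interior_lt x (a : R) : (edom g)° x -> g x < a%:E ->
  \forall n \near \oo, F n x < a%:E.
Proof.
move=> gx gxa; have [r r0 [M FM]] := epi_locally_bounded gx.
have [a1 a1a gxa1] : exists2 a1 : R, (a1 < a)%R & g x < a1%:E.
  have := g0 x; case: (g x) gxa => [b| |]// ba _.
  by exists ((a + b) / 2)%R; rewrite ?lte_fin in ba *; lra.
pose K : R := (`|M - a1| + 1)%R.
have K0 : (0 < K)%R by rewrite ltr_wpDl.
pose e : R := (a - a1)%R.
have e0 : (0 < e)%R by rewrite subr_gt0.
(* any t in ]0, 1[ with t K < e does *)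
pose t : R := (e / (e + K))%R.
have t0 : (0 < t)%R by rewrite divr_gt0// addr_gt0.
have t1 : (t < 1)%R by rewrite /t ltr_pdivrMr; [lra|exact: addr_gt0].
have tK : (t * K < e)%R.
  rewrite /t mulrAC ltr_pdivrMr; last exact: addr_gt0.
  by have := mulr_gt0 e0 e0; lra.
have tM : ((1 - t) * a1 + t * M < a)%R.
  have : (t * (M - a1) <= t * K)%R.
    apply: ler_wpM2l; first exact: ltW.
    by rewrite (le_trans (ler_norm _))// /K lerDl.
  rewrite /e in tK; lra.
have FU := Fg gxa1 (nbhs_box x (mulr_gt0 t0 r0)).
apply: filterS (filterI FM FU) => n [Fn [y xy Fy]].
pose z := (t^-1 *: (x - (1 - t) *: y))%R.
have xz : box x r z.
  move=> i; have := xy i; rewrite -!ball_normE /= !mxE => xyi.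
  have -> : (x ord0 i - t^-1 * (x ord0 i - (1 - t) * y ord0 i) =
    t^-1 * ((1 - t) * (y ord0 i - x ord0 i)))%R by field; rewrite gt_eqF.
  rewrite normrM gtr0_norm ?invr_gt0// ltr_pdivrMl// (le_lt_trans _ xyi)//.
  rewrite normrM (distrC (y ord0 i)) gtr0_norm ?subr_gt0//.
  by rewrite ler_piMl//; lra.
have xE : x = ((1 - t) *: y + (1 - (1 - t)) *: z)%R.
  by rewrite subKr scalerA divff ?gt_eqF// scale1r addrC subrK.
have t01 : (0 <= 1 - t <= 1)%R by lra.
rewrite {1}xE; apply: le_lt_trans (Fcvx n y z t01) _.
rewrite subKr; apply: le_lt_trans (_ : _ <= ((1 - t) * a1 + t * M)%:E) _.
  rewrite [leRHS]EFinD !EFinM; apply: leeD; apply: lee_wpmul2l.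
  - by rewrite lee_fin subr_ge0 ltW.
  - exact: ltW.
  - by rewrite lee_fin ltW.
  - exact: Fn.
by rewrite lte_fin.
Qed.

End recovery.

(** Fatou's lemma, with the lower limit of the integrands bounded from below by
    npoweR (g x) b off the null set formed by the boundary of the domain. *)
Lemma fatou_npoweR (F : nat -> V -> \bar R) g (b : R) :
  epi_cvg F g -> (forall n x, 0 <= F n x) -> (forall n, econvex (F n)) ->
  (forall n, lower_semicontinuous (F n)) -> (b < 0)%R ->
  (edom g)° !=set0 ->
  \int[mu]_x npoweR (g x) b <=
  limn_einf (fun n => \int[mu]_x npoweR (F n x) b).
Proof.
move=> Fg F0 Fc Fl b0 gi.
have g0 := epi_ge0 Fg F0.
have mF n := measurable_npoweR_lsc b (Fl n).
apply: le_trans (fatou mu measurableT mF (fun n x _ => npoweR_ge0 _ _)).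
apply: ae_ge0_le_integral => //.
- by move=> x _; exact: npoweR_ge0.
- by apply: measurable_npoweR_lsc; exact: epi_lsc Fg.
- move=> x _; apply: limn_einf_ge => c c0; apply: nearW => n.
  exact: le_trans (ltW c0) (npoweR_ge0 _ _).
- apply: measurableT_comp; first exact: oppe_measurable.
  apply: (measurable_fun_limn_esup
    (f := fun n (x : borelRd R d) => - npoweR (F n x) b)).
  by move=> n; apply: measurableT_comp (mF n); exact: oppe_measurable.
have cdom := edom_cvx g0 (epi_convex Fg F0 Fc).
apply: (negligibleS _ (cvx_boundary_null cdom gi)).
move=> x /= nx; apply: contrapT => nb; apply: nx => _.
have [gx|gx] := eqVneq (g x) +oo.
  rewrite gx /=; apply: limn_einf_ge => c c0; apply: nearW => n.
  exact: le_trans (ltW c0) (npoweR_ge0 _ _).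
have xi : (edom g)° x.
  apply: contrapT => xi; apply: nb; split=> //; apply: subset_closure.
  by rewrite /edom /= ltey.
by apply: npoweR_liminf => // a; exact: (epi_interior_lt Fg.1).
Qed.

End convex_functions.

(** * Convex functions with an integrable negative power *)

Section finite_integral.
Context {R : realType} {d : nat}.
Local Notation V := 'rV[R]_d.
Local Notation mu := (lebesgueRd R d).
Local Open Scope ereal_scope.
Variables (g : V -> \bar R) (b : R).
Hypothesis g0 : forall x, 0 <= g x.
Hypothesis gl : lower_semicontinuous g.
Hypothesis gc : econvex g.
Hypothesis bd : (b < - d%:R)%R.
Hypothesis gdom : (edom g)° !=set0.
Hypothesis gint : \int[mu]_x npoweR (g x) b < +oo.

Let b0 : (b < 0)%R.
Proof. by apply: lt_le_trans bd _; rewrite oppr_le0. Qed.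

Lemma bounded_box : exists c : V, exists2 r : R, (0 < r)%R &
  exists2 M : R, (0 < M)%R & forall y, box c r y -> g y <= M%:E.
Proof.
have [c cg] := gdom; exists c.
have gg x (a : R) (U : set V) : g x < a%:E -> nbhs x U ->
    \forall n \near \oo, exists2 y, U y & (fun=> g) n y < a%:E.
  by move=> gxa /nbhs_singleton Ux; apply: nearW => _; exists x.
have [r r0 [M FM]] := epi_locally_bounded gg g0 (fun=> gc) cg.
exists r => //; have [n {}FM] := filter_ex FM.
exists (`|M| + 1)%R; first by rewrite ltr_wpDl.
move=> y /FM /le_trans; apply.
by rewrite lee_fin (le_trans (ler_norm _))// lerDl.
Qed.

Let mpsi : measurable_fun [set: borelRd R d]
  (fun x : borelRd R d => npoweR (g x) b).
Proof. exact: measurable_npoweR_lsc. Qed.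

Lemma npoweR_markov (A : set V) (M : R) : (0 < M)%R ->
  measurable (A : set (borelRd R d)) ->
  A `<=` [set x | g x <= M%:E] ->
  (M `^ b)%:E * mu A <= \int[mu]_x npoweR (g x) b.
Proof.
move=> M0 mA AM; apply: (@le_trans _ _ (\int[mu]_(x in A) npoweR (g x) b)).
  rewrite -integral_cst//; apply: ge0_le_integral => //.
  - by move=> x _; rewrite lee_fin powR_ge0.
  - exact: measurable_funTS.
  - move=> x /AM gM; rewrite -npoweR_gt0E//.
    by apply: npoweR_le => //; exact: ltW.
apply: ge0_subset_integral => // x _; exact: npoweR_ge0.
Qed.

(** If g x <= e, then g <= 2e on the image of the cube where g <= M under the
    contraction with centre x and ratio t = e / M. That image has volume of
    order e^d, so the integral is at least C e^(b + d), and e is chosen to make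
    this exceed the integral. *)
Lemma bounded_away_of_finite_integral : bounded_away_from_zero g.
Proof.
have [c [r r0 [M M0 gM]]] := bounded_box.
set I := \int[mu]_x npoweR (g x) b.
have I0 : 0 <= I by apply: integral_ge0 => x _; exact: npoweR_ge0.
have Ifin : I \is a fin_num by rewrite ge0_fin_numE.
have IE : I = (fine I)%:E by rewrite fineK.
pose C : R := (2 `^ b * (2 * r / M) ^+ d)%R.
have C0 : (0 < C)%R.
  by rewrite mulr_gt0 ?powR_gt0// exprn_gt0// divr_gt0// mulr_gt0.
pose K : R := ((fine I + 1) / C)%R.
have K0 : (0 < K)%R by rewrite divr_gt0// ltr_wpDl// fine_ge0.
have bdneg : (b + d%:R < 0)%R by rewrite -ltrBrDr sub0r.
pose e : R := Num.min (K `^ (b + d%:R)^-1)%R M.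
have e0 : (0 < e)%R by rewrite lt_min powR_gt0.
have eM : (e <= M)%R by rewrite ge_min lexx orbT.
have eK : (K <= e `^ (b + d%:R))%R.
  rewrite -[leLHS](@powR_invK _ K (b + d%:R)%R)//; last by rewrite lt_eqF.
  by apply: powR_le_neg => //; [rewrite ge_min lexx|exact: ltW].
exists e => // x; rewrite leNgt; apply/negP => gxe.
pose t : R := (e / M)%R.
have t0 : (0 < t)%R by rewrite divr_gt0.
have t1 : (t <= 1)%R by rewrite ler_pdivrMr// mul1r.
pose B : set V := box ((1 - t) *: x + t *: c)%R (t * r)%R.
have mB : measurable (B : set (borelRd R d)) by exact: measurable_boxRd.
have Bg : B `<=` [set y | g y <= (2 * e)%:E].
  move=> y By.
  pose z := (t^-1 *: (y - (1 - t) *: x))%R.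
  have yE : y = ((1 - t) *: x + (1 - (1 - t)) *: z)%R.
    by rewrite subKr scalerA divff ?gt_eqF// scale1r addrC subrK.
  have cz : box c r z.
    move=> i; have := By i; rewrite -!ball_normE /= !mxE => h.
    have -> : (c ord0 i - t^-1 * (y ord0 i - (1 - t) * x ord0 i) =
      t^-1 * ((1 - t) * x ord0 i + t * c ord0 i - y ord0 i))%R.
      by field; rewrite gt_eqF.
    by rewrite normrM gtr0_norm ?invr_gt0// ltr_pdivrMl.
  have t01 : (0 <= 1 - t <= 1)%R by lra.
  rewrite /= {1}yE; apply: le_trans (gc x z t01) _; rewrite subKr.
  have -> : (2 * e)%:E = e%:E + t%:E * M%:E.
    by rewrite -EFinM -EFinD; congr EFin; rewrite /t divfK ?gt_eqF//; ring.
  apply: leeD.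
    apply: (@le_trans _ _ (1%:E * g x)).
      by apply: lee_wpmul2r => //; rewrite lee_fin; lra.
    by rewrite mul1e ltW.
  by apply: lee_wpmul2l; [rewrite lee_fin ltW|exact: gM].
have e20 : (0 < 2 * e)%R by rewrite mulr_gt0.
have := npoweR_markov e20 mB Bg; rewrite -/I IE.
have tr0 : (0 <= t * r)%R by rewrite mulr_ge0// ltW.
rewrite [X in _ * X](@lebesgueRd_cube R d _ _ tr0) -EFinM lee_fin leNgt.
move=> /negP; apply.
have -> : ((2 * e) `^ b * (t * r *+ 2) ^+ d = C * e `^ (b + d%:R))%R.
  rewrite powRM ?ltW// powRD; last by rewrite (gt_eqF e0) implybT.
  rewrite (powR_mulrn _ (ltW e0)) /C.
  have -> : (t * r *+ 2 = (2 * r / M) * e)%R.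
    by rewrite /t; field; rewrite gt_eqF.
  rewrite exprMn; ring.
have : (C * K <= C * e `^ (b + d%:R))%R by apply: ler_wpM2l => //; exact: ltW.
rewrite /K mulrC divfK ?gt_eqF//; lra.
Qed.

(** A sublevel set S has finite measure, so the part of S outside a large cube
    has measure less than r^d. But for x in S, the points halfway between x and
    the cube of radius r where g is bounded form a cube of side r in S, which
    lies far away when x does. *)
Lemma coercive_of_finite_integral : ecoercive g.
Proof.
have [c [r r0 [M1 M10 gM1]]] := bounded_box.
move=> M0; pose M : R := Num.max M0 M1.
have MM1 : (M1 <= M)%R by rewrite le_max lexx orbT.
have M_gt0 : (0 < M)%R by exact: lt_le_trans MM1.
pose S : set V := [set x | g x <= M%:E].
have mS : measurable (S : set (borelRd R d)).
  have -> : S = ~` [set x | M%:E < g x].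
    by rewrite /S; apply/seteqP; split => x /=; rewrite leNgt => /negP.
  apply: measurableC; apply: open_measurableRd.
  exact: (lower_semicontinuousP g).1.
have muS : mu S < +oo.
  rewrite ltNge leye_eq; apply/negP => /eqP muS.
  have := npoweR_markov M_gt0 mS (@subset_refl _ S).
  rewrite [X in _ * X]muS gt0_muley ?lte_fin ?powR_gt0// leye_eq => /eqP E.
  by move: gint; rewrite E ltxx.
pose A (k : nat) : set (borelRd R d) := S `\` box (0%R : V) k%:R.
have mA k : measurable (A k).
  by apply: measurableD => //; exact: measurable_boxRd.
have capA : \bigcap_k A k = set0.
  apply/seteqP; split => // x /(_ (Num.truncn (norm1 x)).+1 I) [_]; apply.
  apply: norm1_box; exact: truncnS_gt.
have cvgA : mu \o A @ \oo --> mu (\bigcap_n A n).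
  apply: nonincreasing_cvg_mu => //.
  - apply: le_lt_trans muS; rewrite le_measure ?inE//; exact: subDsetl.
  - by rewrite capA.
  - move=> m n mn; apply/subsetPset => x [Sx nx]; split=> // mx; apply: nx.
    by apply: box_le mx; rewrite ler_nat.
rewrite capA measure0 in cvgA.
have rd0 : 0 < ((r / 2 *+ 2) ^+ d)%:E.
  by rewrite lte_fin exprn_gt0// pmulrn_rgt0// divr_gt0.
have [k _ kA] := cvgA _ (open_ereal_lt' rd0).
have {}kA : mu (A k) < ((r / 2 *+ 2) ^+ d)%:E by apply: kA => /=.
pose L : R := (2 * k%:R + norm1 c + r)%R.
have L0 : (0 < L)%R by rewrite ltr_wpDl// addr_ge0 ?norm1_ge0// mulr_ge0.
exists (d%:R * L)%R => x xL.
apply: (@le_trans _ _ M%:E); first by rewrite lee_fin le_max lexx.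
have [i xi] : exists i, (L <= `|x ord0 i|)%R.
  apply: contrapT => /forallNP h.
  move: xL; rewrite ltNge => /negP; apply.
  apply: le_trans (enorm_le_norm1 x) _.
  rewrite mulr_natl -[X in (_ *+ X)%R]card_ord -sumr_const.
  by apply: ler_sum => i _; rewrite leNgt; apply/negP => /ltW; exact: h.
rewrite leNgt; apply/negP => gxM.
pose B : set V := box (2^-1 *: x + (1 - 2^-1) *: c)%R (r / 2)%R.
have BA : B `<=` A k.
  move=> y By; pose z := (2 *: y - x)%R.
  have yE : y = (2^-1 *: x + (1 - 2^-1) *: z)%R.
    by apply/rowP => j; rewrite !mxE; field.
  split.
    rewrite yE; apply: (sublevel_cvx gc) => /=; [lra|exact: ltW|].
    apply: le_trans (gM1 _ _) _; last by rewrite lee_fin.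
    move=> j; have := By j; rewrite -!ball_normE /= !mxE => h.
    have -> : (c ord0 j - (2 * y ord0 j - x ord0 j) =
      2 * (2^-1 * x ord0 j + (1 - 2^-1) * c ord0 j - y ord0 j))%R by field.
    by rewrite normrM ger0_norm// mulrC -ltr_pdivlMr.
  move=> /(_ i); have := By i.
  rewrite -!ball_normE /= !mxE sub0r normrN => h1 h2.
  have ci : (`|c ord0 i| <= norm1 c)%R.
    by rewrite /norm1 (bigD1 i)//= lerDl sumr_ge0.
  have : (`|x ord0 i| < L)%R; last by rewrite ltNge xi.
  have -> : (x ord0 i =
    2 * (2^-1 * x ord0 i + (1 - 2^-1) * c ord0 i - y ord0 i)
    + 2 * y ord0 i - c ord0 i)%R by field.
  apply: le_lt_trans (ler_normB _ _) _.
  apply: le_lt_trans (lerD (ler_normD _ _) (lexx _)) _.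
  rewrite !normrM (@ger0_norm _ 2)// /L; lra.
have : mu B <= mu (A k).
  by rewrite le_measure ?inE//; exact: measurable_boxRd.
rewrite leNgt => /negP; apply; apply: lt_le_trans kA _.
by rewrite [leRHS]lebesgueRd_cube// ltW// divr_gt0.
Qed.

End finite_integral.

(** * The mass of the minimizing density *)

Section density.
Context {R : realType} {d : nat}.
Local Notation V := 'rV[R]_d.
Local Notation mu := (lebesgueRd R d).
Local Open Scope ereal_scope.
Implicit Types (g h : V -> \bar R) (Q : probability (borelRd R d) R).

Lemma classG_shift g (e : R) : classG g -> (forall x, 0 <= g x + e%:E) ->
  classG (fun x => g x + e%:E).
Proof.
case=> g0 gl gc gd gco ge0; split => //.
- move=> x a; rewrite -lteBlDr// -EFinB => /gl[W Wx Wa]; exists W => // y /Wa.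
  by rewrite EFinB lteBlDr.
- move=> x y t t01; apply: (le_trans (leeD (gc x y t t01) (lexx e%:E))).
  rewrite !muleDr// ?fin_num_adde_defl//.
  rewrite addeACA leeD2l// -!EFinM -EFinD lee_fin.
  lra.
- have [x gx] := gd; exists x; apply: filterS gx => y.
  by rewrite /edom /= => gy; apply: lte_add_pinfty => //; exact: ltry.
- move=> M; have [r rM] := gco (M - e)%R; exists r => x /rM.
  by rewrite EFinB leeBlDr.
Qed.

Lemma integral_shift Q g (e : R) : (0 <= e)%R -> (forall x, 0 <= g x) ->
  lower_semicontinuous g ->
  \int[Q]_x (g x + e%:E) = \int[Q]_x g x + e%:E.
Proof.
move=> e0 g0 gl; rewrite ge0_integralD//; last exact: lsc_measurableRd.
by congr (_ + _); rewrite integral_cst// [X in _ * X]probability_setT mule1.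
Qed.

Section minimizer.
Variables (s : R) (g : V -> \bar R) (Q : probability (borelRd R d) R).
Let b : R := (1 + s^-1)%R.
Hypothesis b0 : (b < 0)%R.
Hypothesis gG : classG g.
Hypothesis gmin : forall h, classG h -> Ls s g Q <= Ls s h Q.
Hypothesis gfin : Ls s g Q \is a fin_num.
Variable c : R.
Hypothesis c0 : (0 < c)%R.
Hypothesis gc : forall x, c%:E <= g x.

Let g0 := classG_ge0 gG.
Let gl := classG_lsc gG.

Let sE : (s^-1 = b - 1)%R. Proof. by rewrite /b addrAC subrr add0r. Qed.
Let g_gt0 x : 0 < g x.
Proof. by apply: lt_le_trans (gc x); rewrite lte_fin. Qed.
Let B0 : (0 < `|b|)%R. Proof. by rewrite normr_gt0 lt_eqF. Qed.

Let int_ge0 h p : 0 <= \int[mu]_x npoweR (h x) p.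
Proof. by apply: integral_ge0 => x _; exact: npoweR_ge0. Qed.

Let Qfin : \int[Q]_x g x \is a fin_num.
Proof.
have Q0 : 0 <= \int[Q]_x g x by apply: integral_ge0 => x _; exact: g0.
rewrite ge0_fin_numE//; move: gfin; rewrite /Ls -/b ge0_fin_numE; last first.
  by rewrite adde_ge0// mule_ge0// lee_fin.
by apply: le_lt_trans; rewrite leeDl// mule_ge0// lee_fin.
Qed.

Let Jfin : \int[mu]_x npoweR (g x) b \is a fin_num.
Proof.
have Q0 : 0 <= \int[Q]_x g x by apply: integral_ge0 => x _; exact: g0.
rewrite ge0_fin_numE// ltNge leye_eq; apply/negP => /eqP E.
move: gfin; rewrite /Ls -/b E gt0_muley ?lte_fin ?invr_gt0// addey//.
by rewrite gt_eqF// (lt_le_trans _ Q0).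
Qed.

(** Passing from g to g + e increases the first part of the functional by e, so
    by minimality the integral of g^b drops by at most |b| e; by convexity it
    drops by at least |b| e times the integral of (g + e)^(b - 1). *)
Lemma mass_above_le1 (e : R) : (0 < e)%R ->
  \int[mu]_x npoweR (g x + e%:E) s^-1%R <= 1.
Proof.
move=> e0; set h := fun x => g x + e%:E.
have h_gt0 x : 0 < h x by rewrite adde_gt0// lte_fin.
have hG : classG h by apply: classG_shift => // x; exact: (ltW (h_gt0 x)).
have hl := classG_lsc hG.
set J := \int[mu]_x npoweR (g x) b; set Je := \int[mu]_x npoweR (h x) b.
set P := \int[mu]_x _.
have JeJ : Je + (`|b| * e)%:E * P <= J.
  rewrite -ge0_integralZl//; last 3 first.
  - exact: measurable_npoweR_lsc.
  - by move=> x _; exact: npoweR_ge0.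
  - by rewrite lee_fin mulr_ge0// ltW.
  rewrite -ge0_integralD//; last 4 first.
  - by move=> x _; exact: npoweR_ge0.
  - exact: measurable_npoweR_lsc.
  - by move=> x _; rewrite mule_ge0 ?npoweR_ge0// lee_fin mulr_ge0// ltW.
  - by apply: measurable_funeM; exact: measurable_npoweR_lsc.
  apply: ge0_le_integral => //.
  - move=> x _; rewrite adde_ge0 ?npoweR_ge0// mule_ge0 ?npoweR_ge0//.
    by rewrite lee_fin mulr_ge0// ltW.
  - apply: emeasurable_funD; first exact: measurable_npoweR_lsc.
    by apply: measurable_funeM; exact: measurable_npoweR_lsc.
  - exact: measurable_npoweR_lsc.
  - by move=> x _; rewrite sE; exact: npoweR_tangent_above.
have P0 : 0 <= P by exact: int_ge0.
have bP0 : 0 <= (`|b| * e)%:E * P by rewrite mule_ge0// lee_fin mulr_ge0// ltW.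
have Jefin : Je \is a fin_num.
  rewrite ge0_fin_numE; last exact: int_ge0.
  apply: (@le_lt_trans _ _ J); first by apply: le_trans JeJ; rewrite leeDl.
  by rewrite -ge0_fin_numE ?int_ge0.
have := gmin hG; rewrite /Ls -/b -/J -/Je integral_shift//; last exact: ltW.
have JF : J \is a fin_num := Jfin.
rewrite -(fineK Qfin) -(fineK Jefin) -(fineK JF) -!EFinM -!EFinD lee_fin => h1.
have h2 : (fine J <= fine Je + `|b| * e)%R.
  have : (`|b| * (`|b|^-1 * fine J) <= `|b| * (e + `|b|^-1 * fine Je))%R.
    by rewrite ler_wpM2l//; lra.
  by rewrite mulrDr !mulVKf ?gt_eqF//; lra.
move: JeJ; rewrite -(fineK Jefin) -(fineK JF) addeC -leeBrDr// -EFinB.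
rewrite muleC -lee_pdivlMr ?mulr_gt0// => /le_trans; apply.
rewrite -EFinM lee_fin ler_pdivrMr ?mulr_gt0// mul1r; lra.
Qed.

(** The same comparison with g - e, which decreases the first part by e. *)
Lemma mass_below_ge1 (e : R) : (0 < e < c)%R ->
  1 <= \int[mu]_x npoweR (g x - e%:E) s^-1%R.
Proof.
move=> /andP[e0 ec]; set h := fun x => g x - e%:E.
have h_gt0 x : 0 < h x.
  by rewrite sube_gt0; apply: lt_le_trans (gc x); rewrite lte_fin.
have h0 x : 0 <= h x by exact: ltW.
have hG : classG h by apply: (classG_shift (e := - e)%R).
have hl := classG_lsc hG.
have gE : g = fun x => h x + e%:E by apply/funext => x; rewrite /h subeK.
set J := \int[mu]_x npoweR (g x) b; set Jh := \int[mu]_x npoweR (h x) b.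
set P := \int[mu]_x _.
have P0 : 0 <= P by exact: int_ge0.
have JhJ : Jh <= J + (`|b| * e)%:E * P.
  rewrite -ge0_integralZl//; last 3 first.
  - exact: measurable_npoweR_lsc.
  - by move=> x _; exact: npoweR_ge0.
  - by rewrite lee_fin mulr_ge0// ltW.
  rewrite -ge0_integralD//; last 4 first.
  - by move=> x _; exact: npoweR_ge0.
  - exact: measurable_npoweR_lsc.
  - by move=> x _; rewrite mule_ge0 ?npoweR_ge0// lee_fin mulr_ge0// ltW.
  - by apply: measurable_funeM; exact: measurable_npoweR_lsc.
  apply: ge0_le_integral => //.
  - by move=> x _; exact: npoweR_ge0.
  - exact: measurable_npoweR_lsc.
  - apply: emeasurable_funD; first exact: measurable_npoweR_lsc.
    by apply: measurable_funeM; exact: measurable_npoweR_lsc.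
  - move=> x _; rewrite sE; have := npoweR_tangent_below e0 b0 (h_gt0 x).
    by rewrite {2}/h subeK.
have Qg : \int[Q]_x g x = \int[Q]_x h x + e%:E.
  by rewrite gE integral_shift// ltW.
have Qhfin : \int[Q]_x h x \is a fin_num.
  move: Qfin; rewrite Qg.
  by rewrite fin_numD => /andP[].
have := gmin hG; rewrite /Ls -/b -/J -/Jh Qg -addeA leeD2lE//.
move=> h1; have JF : J \is a fin_num := Jfin.
clearbody P; case: P P0 JhJ => [P'| |] // P0 JhJ; last by rewrite leey.
have Jhfin : Jh \is a fin_num.
  rewrite ge0_fin_numE; last exact: int_ge0.
  by apply: le_lt_trans JhJ _; rewrite -(fineK JF) -EFinM -EFinD ltry.
move: JhJ h1.
rewrite -(fineK Jhfin) -(fineK JF) -!EFinM -!EFinD !lee_fin => h2 h1.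
have h3 : (`|b| * (e + `|b|^-1 * fine J) <= `|b| * (`|b|^-1 * fine Jh))%R.
  by rewrite ler_wpM2l.
have be0 : (0 < `|b| * e)%R by rewrite mulr_gt0.
rewrite -(ler_pM2l be0).
by move: h3; rewrite mulrDr !mulVKf ?gt_eqF//; lra.
Qed.

(** As g >= c, adding c (u - 1) raises g at most by the factor u and subtracting
    c (1 - 1/u) lowers it at most by the factor 1/u. So the mass I satisfies
    u^(1/s) I <= 1 and u^(1/s) <= I for every u > 1. *)
Lemma minimizer_density : \int[mu]_x npoweR (g x) s^-1%R = 1.
Proof.
have p0 : (s^-1 < 0)%R by move: b0; rewrite /b; lra.
set I := \int[mu]_x _; have I0 : 0 <= I by exact: int_ge0.
have above u : (1 < u)%R -> (u `^ s^-1)%:E * I <= 1.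
  move=> u1; have u0 := lt_trans ltr01 u1.
  have e0 : (0 < c * (u - 1))%R by rewrite mulr_gt0// subr_gt0.
  apply: le_trans (mass_above_le1 e0).
  rewrite -ge0_integralZl//; last 3 first.
  - exact: measurable_npoweR_lsc.
  - by move=> x _; exact: npoweR_ge0.
  - by rewrite lee_fin powR_ge0.
  apply: ge0_le_integral => //.
  - by move=> x _; rewrite mule_ge0 ?npoweR_ge0// lee_fin powR_ge0.
  - by apply: measurable_funeM; exact: measurable_npoweR_lsc.
  - apply: measurable_npoweR_lsc; apply: classG_lsc.
    apply: classG_shift => // x.
    by rewrite adde_ge0// lee_fin ltW.
  - move=> x _; rewrite -npoweR_scale//; apply: npoweR_le; first exact: ltW.
      by rewrite adde_ge0// lee_fin ltW.
    case: (g x) (gc x) => [y| |] // cy; last first.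
      by rewrite gt0_muley ?lte_fin// leey.
    rewrite lee_fin in cy; rewrite -EFinD -EFinM lee_fin.
    have : (c * (u - 1) <= y * (u - 1))%R.
      by apply: ler_wpM2r => //; rewrite subr_ge0 ltW.
    lra.
have below u : (1 < u)%R -> 1 <= (u^-1 `^ s^-1)%:E * I.
  move=> u1; have u0 := lt_trans ltr01 u1.
  have v0 : (0 < u^-1)%R by rewrite invr_gt0.
  have v1 : (u^-1 < 1)%R by rewrite invf_lt1.
  have ec : (0 < c * (1 - u^-1) < c)%R.
    rewrite mulr_gt0 ?subr_gt0//= -[ltRHS]mulr1 ltr_pM2l//; lra.
  have ge0 x : 0 <= g x - (c * (1 - u^-1))%:E.
    rewrite sube_ge0//; apply: le_trans (gc x).
    by rewrite lee_fin; case/andP: ec => _ /ltW.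
  apply: le_trans (mass_below_ge1 ec) _.
  rewrite -ge0_integralZl//; last 3 first.
  - exact: measurable_npoweR_lsc.
  - by move=> x _; exact: npoweR_ge0.
  - by rewrite lee_fin powR_ge0.
  apply: ge0_le_integral => //.
  - by move=> x _; exact: npoweR_ge0.
  - apply: measurable_npoweR_lsc; apply: classG_lsc.
    exact: (classG_shift (e := (- (c * (1 - u^-1)))%R)).
  - by apply: measurable_funeM; exact: measurable_npoweR_lsc.
  - move=> x _; rewrite -npoweR_scale//; apply: npoweR_le; first exact: ltW.
      by rewrite mule_ge0// lee_fin ltW.
    case: (g x) (gc x) => [y| |] // cy; last by rewrite leey.
    rewrite lee_fin in cy; rewrite -EFinB -EFinM lee_fin.
    have : (c * (1 - u^-1) <= y * (1 - u^-1))%R.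
      by apply: ler_wpM2r => //; rewrite subr_ge0 ltW.
    lra.
have Ifin : I \is a fin_num.
  rewrite ge0_fin_numE// ltNge leye_eq; apply/negP => /eqP E.
  by have := above 2%R (ltr1n _ 2); rewrite E gt0_muley ?lte_fin ?powR_gt0.
rewrite -(fineK Ifin); congr EFin.
apply: (eq1_of_powR_bounds p0) => u u1.
have u0 := lt_trans ltr01 u1.
split; first by have := above u u1; rewrite -(fineK Ifin) -EFinM lee_fin.
have := below u u1; rewrite -(fineK Ifin) -EFinM lee_fin => h.
have up : (0 < u `^ s^-1)%R by exact: powR_gt0.
have uV : (u `^ s^-1 * u^-1 `^ s^-1 = 1)%R.
  by rewrite -powRM ?invr_ge0 ?(ltW u0)// divff ?gt_eqF// powR1.
by move: h; rewrite -(ler_pM2l up) mulr1 mulrA uV mul1r.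
Qed.

End minimizer.
End density.

(** * Existence of a minimizer *)

Section liminf.
Context {R : realType}.
Local Open Scope ereal_scope.
Implicit Types (u v : nat -> \bar R).

Lemma lt_limn_einf u (c : R) : c%:E < limn_einf u ->
  \forall n \near \oo, c%:E <= u n.
Proof.
rewrite limn_einf_lim; have /cvg_lim -> // := @cvg_einfs_sup _ u.
move=> /ereal_sup_gt[_ [N _ <-]] cN.
exists N => // n /= Nn; apply: le_trans (ltW cN) _.
by apply: ereal_inf_lbound; exists n.
Qed.

Lemma limn_einfD_le u v : (forall n, 0 <= u n) -> (forall n, 0 <= v n) ->
  limn_einf u + limn_einf v <= limn_einf (fun n => u n + v n).
Proof.
move=> u0 v0; rewrite !limn_einf_lim.
have e0 w n : (forall n, 0 <= w n) -> 0 <= einfs w n.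
  by move=> w0; apply: le_ereal_inf_tmp => _ [k _ <-].
have l0 w : (forall n, 0 <= w n) -> 0 <= limn (einfs w).
  move=> w0; apply: lime_ge; first exact: is_cvg_einfs.
  by apply: nearW => n; exact: e0.
rewrite -limeD; [|exact: is_cvg_einfs|exact: is_cvg_einfs|]; last first.
  by apply: ge0_adde_def; rewrite inE; exact: l0.
apply: lee_lim.
- apply: is_cvgeD; [|exact: is_cvg_einfs|exact: is_cvg_einfs].
  by apply: ge0_adde_def; rewrite inE; exact: l0.
- exact: is_cvg_einfs.
- apply: nearW => n; apply: le_ereal_inf_tmp => _ [k nk <-].
  by apply: leeD; apply: ereal_inf_lbound; exists k.
Qed.

Lemma limn_einfZ_le u (k : R) : (0 < k)%R ->
  k%:E * limn_einf u <= limn_einf (fun n => k%:E * u n).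
Proof.
move=> k0; apply: limn_einf_ge => c.
rewrite -lte_pdivrMl// -EFinM => /lt_limn_einf; apply: filterS => n.
by rewrite EFinM lee_pdivrMl.
Qed.

Lemma le_limn_einf u v : (\forall n \near \oo, u n <= v n) ->
  limn_einf u <= limn_einf v.
Proof.
move=> uv; apply: limn_einf_ge => c /lt_limn_einf cu.
by apply: filterS (filterI uv cu) => n [h1 h2]; exact: le_trans h2 h1.
Qed.

Lemma limn_einf_le_approx u (m : R) :
  (forall n, u n <= (m + n.+1%:R^-1)%:E) -> limn_einf u <= m%:E.
Proof.
move=> um; rewrite leNgt; apply/negP => /lt_EFin_between[c mc /lt_limn_einf cu].
have e0 : (0 < c - m)%R by rewrite subr_gt0.
have [n [cn ne]] := filter_ex (filterI cu (near_infty_natSinv_lt (PosNum e0))).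
have := le_trans cn (um n); rewrite lee_fin leNgt => /negP; apply.
by move: ne => /=; rewrite ltrBrDl.
Qed.

End liminf.

Section existence.
Context {R : realType} {d : nat}.
Local Notation V := 'rV[R]_d.
Local Notation mu := (lebesgueRd R d).
Local Open Scope ereal_scope.
Implicit Types (g h : V -> \bar R).
Variables (s : R) (Q : probability (borelRd R d) R).
Hypothesis s1 : (- (d.+1%:R)^-1 < s)%R.
Hypothesis s0 : (s < 0)%R.
Hypothesis Q0 : classQ0 Q.
Hypothesis Q1 : classQ1 Q.
Let b : R := (1 + s^-1)%R.

Let bd : (b < - d%:R)%R. Proof. exact: exponent_lt. Qed.

Let b0 : (b < 0)%R.
Proof. by apply: lt_le_trans bd _; rewrite oppr_le0. Qed.

Let B0 : (0 < `|b|^-1)%R. Proof. by rewrite invr_gt0 normr_gt0 lt_eqF. Qed.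

Lemma Ls_ge0 h : (forall x, 0 <= h x) -> 0 <= Ls s h Q.
Proof.
move=> h0; rewrite /Ls adde_ge0//; first by apply: integral_ge0.
by rewrite mule_ge0 ?lee_fin// integral_ge0// => x _; exact: npoweR_ge0.
Qed.

(** A finite value of the functional forces the conditions of the class that
    epi-limits do not inherit directly. *)
Lemma classG_of_finite g : (forall x, 0 <= g x) -> lower_semicontinuous g ->
  econvex g -> Ls s g Q < +oo -> classG g /\ bounded_away_from_zero g.
Proof.
move=> g0 gl gc gfin.
have Qg0 : 0 <= \int[Q]_x g x by apply: integral_ge0.
have Jg0 : 0 <= \int[mu]_x npoweR (g x) b.
  by apply: integral_ge0 => x _; exact: npoweR_ge0.
have Qgfin : \int[Q]_x g x < +oo.
  by apply: le_lt_trans gfin; rewrite leeDl// mule_ge0// lee_fin.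
have gdom := edom_interior g0 gc gl Q0 Qgfin.
have Jfin : \int[mu]_x npoweR (g x) b < +oo.
  rewrite ltNge leye_eq; apply/negP => /eqP E.
  move: gfin; rewrite /Ls -/b E gt0_muley// addey//.
  by rewrite gt_eqF// (lt_le_trans _ Qg0).
split; last exact: bounded_away_of_finite_integral Jfin.
by split => //; exact: coercive_of_finite_integral Jfin.
Qed.

Lemma minimizer_exists : exists g, [/\ classG g,
  (forall h, classG h -> Ls s g Q <= Ls s h Q), Ls s g Q \is a fin_num &
  bounded_away_from_zero g].
Proof.
pose S : set \bar R := [set Ls s h Q | h in [set h | classG h]].
have inf0 : 0 <= ereal_inf S.
  by apply: le_ereal_inf_tmp => _ [h [h0 _ _ _ _] <-]; exact: Ls_ge0.
have inf_fin : ereal_inf S \is a fin_num.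
  rewrite ge0_fin_numE//; apply: le_lt_trans (Ls_one_plus_norm1 s1 s0 Q1).
  apply: ereal_inf_lbound; exists one_plus_norm1 => //.
  exact: classG_one_plus_norm1.
have /choice[F0 F0P] : forall n : nat, exists h, classG h /\
    Ls s h Q <= (fine (ereal_inf S) + n.+1%:R^-1)%:E.
  move=> n.
  have [|_ [h hG <-] hS] := @lb_ereal_inf_adherent _ S n.+1%:R^-1%R _ inf_fin.
    by rewrite invr_gt0.
  by exists h; split=> //; rewrite EFinD fineK//; exact: ltW.
have [phi [phi_ge [g Fg]]] := epi_compact F0.
pose F n := F0 (phi n).
have FG n : classG (F n) by have [] := F0P (phi n).
have FS n : Ls s (F n) Q <= (fine (ereal_inf S) + n.+1%:R^-1)%:E.
  have [_ h] := F0P (phi n); apply: le_trans h _; rewrite lee_fin lerD2l.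
  by rewrite lef_pV2 ?posrE// ler_nat ltnS.
have Fge0 n := classG_ge0 (FG n).
have Fl n := classG_lsc (FG n).
have Fc n := classG_convex (FG n).
have g0 := epi_ge0 Fg Fge0.
have gl := epi_lsc Fg.
have gc := epi_convex Fg Fge0 Fc.
have liminfLs : limn_einf (fun n => Ls s (F n) Q) <= ereal_inf S.
  by rewrite -(fineK inf_fin); exact: limn_einf_le_approx.
have QF0 n : 0 <= \int[Q]_x F n x by apply: integral_ge0.
have JF0 n : 0 <= (`|b|^-1)%:E * \int[mu]_x npoweR (F n x) b.
  rewrite mule_ge0 ?lee_fin// integral_ge0// => x _; exact: npoweR_ge0.
have fatouQ : \int[Q]_x g x <= limn_einf (fun n => \int[Q]_x F n x).
  have mF n : measurable_fun [set: borelRd R d] (F n : borelRd R d -> \bar R).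
    exact: lsc_measurableRd.
  apply: le_trans (fatou Q measurableT mF (fun n x _ => Fge0 n x)).
  apply: ge0_le_integral => //.
  - exact: lsc_measurableRd.
  - apply: measurableT_comp; first exact: oppe_measurable.
    apply: (measurable_fun_limn_esup (f := fun n (x : borelRd R d) => - F n x)).
    by move=> n; apply: measurableT_comp (mF n); exact: oppe_measurable.
  - by move=> x _; exact: epi_le_liminf.
have Qgfin : \int[Q]_x g x < +oo.
  apply: le_lt_trans fatouQ _; apply: (@le_lt_trans _ _ (ereal_inf S)).
    apply: le_trans liminfLs; apply: le_limn_einf; apply: nearW => n.
    by rewrite /Ls leeDl.
  by rewrite ltey_eq inf_fin.
have gdom := edom_interior g0 gc gl Q0 Qgfin.
have Lsg : Ls s g Q <= ereal_inf S.
  apply: le_trans liminfLs; apply: le_trans (limn_einfD_le QF0 JF0).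
  apply: leeD => //; apply: le_trans (limn_einfZ_le _ B0).
  by apply: lee_wpmul2l; [rewrite lee_fin ltW|exact: fatou_npoweR].
have Lsoo : Ls s g Q < +oo by rewrite (le_lt_trans Lsg)// ltey_eq inf_fin.
have Lsfin : Ls s g Q \is a fin_num by rewrite ge0_fin_numE ?Ls_ge0.
have [gG gb] := classG_of_finite g0 gl gc Lsoo.
exists g; split=> // h hG; apply: le_trans Lsg _.
by apply: ereal_inf_lbound; exists h.
Qed.

End existence.

Theorem theorem2p2 (R : realType) (d : nat) (s : R)
    (Q : probability (borelRd R d) R) :
  (1 <= d)%N ->
  - (d.+1%:R)^-1 < s -> s < 0 ->
  classQ0 Q -> classQ1 Q ->
  exists g : 'rV[R]_d -> \bar R,
    [/\ classG g,
        (forall h : 'rV[R]_d -> \bar R, classG h -> (Ls s g Q <= Ls s h Q)%E),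
        Ls s g Q \is a fin_num,
        bounded_away_from_zero g &
        let f := fun x => npoweR (g x) s^-1 in
        is_density f /\ ebounded f].
Proof.
move=> _ s1 s0 Q0 Q1.
have [g [gG gmin gfin [c c0 gc]]] := minimizer_exists s1 s0 Q0 Q1.
have p0 : s^-1 <= 0 by rewrite invr_le0 ltW.
have b0 : 1 + s^-1 < 0.
  by apply: lt_le_trans (exponent_lt s1 s0) _; rewrite oppr_le0.
exists g; split=> //; first by exists c.
split.
  split; first exact: measurable_npoweR_lsc (classG_lsc gG).
    by move=> x; exact: npoweR_ge0.
  exact: (minimizer_density b0 gG gmin gfin c0 gc).
exists (c `^ s^-1) => x; rewrite gee0_abs ?npoweR_ge0// -npoweR_gt0E//.
by apply: npoweR_le => //; rewrite lee_fin ltW.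
Qed.
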